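(* Let $d,m,N$ be positive integers, $0<\Lambda_1<\dots<\Lambda_N$, $A_1,\dots,A_N\in\mathbb{R}^{d\times d}$, $B\in\mathbb{R}^{d\times m}$, $g\in L^\infty([0,\Lambda_N],\mathbb{R}^{d\times d})$, $q\in[1,+\infty)$. The input-output system $$\begin{cases} x(t)=\sum_{j=1}^N A_j x(t-\Lambda_j)+\int_0^{\Lambda_N} g(s)x(t-s)\,ds+Bu(t), & t\ge \inf\operatorname{supp}(u),\\ x(t)=0, & t<\inf\operatorname{supp}(u),\\ y(t)=x(t-\Lambda_N), & t\ge 0,\end{cases}$$ with inputs $u\in\Omega_q:=\{u\in L^q(\mathbb{R},\mathbb{R}^m): \operatorname{supp}(u)\subseteq\mathbb{R}_- \text{ is compact}\}$, is pseudo-rational of order zero.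
   Context: $\mathcal{E}'(\mathbb{R}_-)$ denotes the distributions on $\mathbb{R}$ with compact support contained in $\mathbb{R}_-=(-\infty,0]$, and $\mathcal{D}'_+(\mathbb{R})$ the distributions with support bounded on the left, which is an algebra under convolution $*$; $\delta_x$ is the Dirac mass at $x$. For $\phi\in L^q_{\rm loc}(\mathbb{R},\mathbb{R}^d)$, $\pi(\phi)$ denotes its restriction to $[0,+\infty)$. The system is called pseudo-rational of order zero if there exist a $d\times d$ matrix $Q$ and a $d\times m$ matrix $P$, both with entries in $\mathcal{E}'(\mathbb{R}_-)$, such that (1) $Q$ has a convolution inverse $Q^{-1}$, a $d\times d$ matrix with entries in $\mathcal{D}'_+(\mathbb{R})$ with $Q^{-1}*Q=Q*Q^{-1}=\delta_0 I_d$, and the distribution $\det(Q^{-1})$ has order zero; (2) for every input $u\in\Omega_q$ the output satisfies $y=\pi(Q^{-1}*P*u)$. *)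

(* Defs.v *)
From HB Require Import structures.
From mathcomp Require Import all_boot all_order all_algebra.
From mathcomp Require Import all_classical all_reals all_analysis.
From mathcomp Require Import fingroup perm.
From Stdlib Require Import ClassicalEpsilon.
Set Implicit Arguments. Unset Strict Implicit. Unset Printing Implicit Defensive.
Import Order.TTheory GRing.Theory Num.Theory.
Import numFieldNormedType.Exports.
Local Open Scope classical_set_scope.
Local Open Scope ring_scope.

Section Distributions.
Variable R : realType.
Local Notation mu := (@lebesgue_measure R).

Definition smooth (f : R -> R) : Prop :=
  forall (n : nat) (x : R), derivable (derive1n n f) x 1.

Definition test_fun (f : R -> R) : Prop :=
  smooth f /\ exists K : R, forall x, K < `|x| -> f x = 0.

(* a distribution is a linear functional; only its values on test
   functions matter *)
Definition pdistr := (R -> R) -> R.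

Definition supported_in (K : R) (f : R -> R) : Prop :=
  forall x, K < `|x| -> f x = 0.

Definition is_distr (T : pdistr) : Prop :=
  (forall (a : R) (f g : R -> R), test_fun f -> test_fun g ->
      T (fun x => a * f x + g x) = a * T f + T g) /\
  (forall K : R, exists (k : nat) (C : R), forall (phi : R -> R) (M : nat -> R),
      test_fun phi -> supported_in K phi ->
      (forall j x, (j <= k)%N -> `|derive1n j phi x| <= M j) ->
      `|T phi| <= C * \sum_(0 <= j < k.+1) M j).

Definition order_zero (T : pdistr) : Prop :=
  forall K : R, exists C : R, forall (phi : R -> R) (M : R),
      test_fun phi -> supported_in K phi ->
      (forall x, `|phi x| <= M) -> `|T phi| <= C * M.

Definition deq (S T : pdistr) : Prop := forall phi, test_fun phi -> S phi = T phi.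

Definition supp_ge (a : R) (T : pdistr) : Prop :=
  forall phi, test_fun phi -> (exists e : R, 0 < e /\ forall x, a - e <= x -> phi x = 0) ->
    T phi = 0.

Definition supp_in (a b : R) (T : pdistr) : Prop :=
  forall phi, test_fun phi ->
    (exists e : R, 0 < e /\ forall x, a - e <= x <= b + e -> phi x = 0) ->
    T phi = 0.

Definition in_Dplus (T : pdistr) : Prop := is_distr T /\ exists a, supp_ge a T.

Definition in_Eminus (T : pdistr) : Prop :=
  is_distr T /\ exists a, a <= 0 /\ supp_in a 0 T.

Definition dzero : pdistr := fun _ => 0.
Definition dadd (S T : pdistr) : pdistr := fun phi => S phi + T phi.
Definition dscale (c : R) (T : pdistr) : pdistr := fun phi => c * T phi.
Definition delta0 : pdistr := fun phi => phi 0.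

(* U = S * T for S, T in D'_+ :
   <S*T, phi> = < S_x , chi(x) < T_y , phi(x+y) > >  for a cut-off chi equal to
   1 near [a, K-b] (supp S in [a,oo), supp T in [b,oo), supp phi in [-K,K]) *)
Definition conv_rel (S T U : pdistr) : Prop :=
  forall (a b K : R) (phi chi : R -> R),
    supp_ge a S -> supp_ge b T -> test_fun phi -> supported_in K phi ->
    test_fun chi -> (forall x, a - 1 <= x <= K - b + 1 -> chi x = 1) ->
    U phi = S (fun x => chi x * T (fun y => phi (x + y))).

(* convolution (well defined on D'_+, where a U with conv_rel always exists) *)
Definition conv (S T : pdistr) : pdistr :=
  epsilon (inhabits dzero) (fun U => conv_rel S T U).

Definition fdistr (f : R -> R) : pdistr :=
  fun phi => Rintegral mu setT (fun x => f x * phi x).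

Definition dmx (n p : nat) := 'I_n -> 'I_p -> pdistr.

Definition dmx_conv (n p r : nat) (M : dmx n p) (N : dmx p r) : dmx n r :=
  fun i j => \big[dadd/dzero]_(k < p) conv (M i k) (N k j).

Definition dmx_deltaI (n : nat) : dmx n n :=
  fun i j => if i == j then delta0 else dzero.

Definition dmx_eq (n p : nat) (M N : dmx n p) : Prop :=
  forall i j, deq (M i j) (N i j).

Definition dmx_det (n : nat) (M : dmx n n) : pdistr :=
  \big[dadd/dzero]_(s : {perm 'I_n})
     dscale ((-1) ^+ s) (\big[conv/delta0]_(i < n) M i (s i)).

Definition nz_near (n : nat) (u : R -> 'cV[R]_n) (t e : R) : set R :=
  [set s | t - e < s < t + e /\ u s != 0].

Definition ess_supp (n : nat) (u : R -> 'cV[R]_n) : set R :=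
  [set t | forall e : R, 0 < e -> (0 < mu (nz_near u t e))%E].

Definition Lq_fun (q : R) (f : R -> R) : Prop :=
  measurable_fun setT f /\
  (\int[mu]_(x in setT) ((`|f x| `^ q)%:E) < +oo)%E.

Definition Lq_loc (q : R) (f : R -> R) : Prop :=
  measurable_fun setT f /\
  forall a b : R, (\int[mu]_(x in `[a, b]) ((`|f x| `^ q)%:E) < +oo)%E.

Definition Omega (q : R) (m : nat) (u : R -> 'cV[R]_m) : Prop :=
  (forall i, Lq_fun q (fun t => u t i 0)) /\
  exists a : R, a <= 0 /\ ess_supp u `<=` `[a, 0].

(* An input-output system is given by the relation  io u y  ("y is the
   output of the system for the input u"). *)
Definition pseudo_rational0 (d m : nat) (q : R)
    (io : (R -> 'cV[R]_m) -> (R -> 'cV[R]_d) -> Prop) : Prop :=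
  exists (Q : dmx d d) (P : dmx d m) (Qinv : dmx d d),
    (forall i j, in_Eminus (Q i j)) /\ (forall i j, in_Eminus (P i j)) /\
    (forall i j, in_Dplus (Qinv i j)) /\
    dmx_eq (dmx_conv Qinv Q) (@dmx_deltaI d) /\
    dmx_eq (dmx_conv Q Qinv) (@dmx_deltaI d) /\
    order_zero (dmx_det Qinv) /\
    forall u y, Omega q u -> io u y ->
      exists z : R -> 'cV[R]_d,
        (forall i, Lq_loc q (fun t => z t i 0)) /\
        dmx_eq (dmx_conv Qinv (dmx_conv P (fun k (_ : 'I_1) => fdistr (fun t => u t k 0))))
               (fun i (_ : 'I_1) => fdistr (fun t => z t i 0)) /\
        {ae mu, forall t, 0 <= t -> y t = z t}.

(* t >= inf supp(u), with the convention inf emptyset = +oo (supp u is closed) *)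
Definition after_supp (m : nat) (u : R -> 'cV[R]_m) (t : R) : Prop :=
  exists s, ess_supp u s /\ s <= t.

Definition DI_io (d m N : nat) (q : R) (Lam : nat -> R) (A : nat -> 'M[R]_(d, d))
    (B : 'M[R]_(d, m)) (g : R -> 'M[R]_(d, d))
    (u : R -> 'cV[R]_m) (y : R -> 'cV[R]_d) : Prop :=
  exists x : R -> 'cV[R]_d,
    (forall i, Lq_loc q (fun t => x t i 0)) /\
    {ae mu, forall t, after_supp u t ->
       x t = \sum_(1 <= j < N.+1) A j *m x (t - Lam j)
             + \col_i (\sum_k Rintegral mu `[0, Lam N] (fun s => g s i k * x (t - s) k 0))
             + B *m u t} /\
    {ae mu, forall t, ~ after_supp u t -> x t = 0} /\
    (forall t, 0 <= t -> y t = x (t - Lam N)).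

End Distributions.

(* Main.v *)
(** With [K = \sum_j A_j delta_{Lam_j} + g 1_[0, Lam_N]], the state equation reads
    [(delta_0 I - K) * x = B u].  Take [Q = delta_{-Lam_N} * (delta_0 I - K)],
    [P = B delta_0], and invert [Q] by [delta_{Lam_N}] times the Neumann series of
    [K]: testing against functions dominated by [e^{-lam t}] makes the total
    variation of [K] smaller than [1/2] for large [lam], so the series converges to
    a matrix of locally finite measures and [det Q^{-1}] has order zero.

    All measures are treated as functionals on smooth functions whose support is
    only bounded on the right, where [(S * T) f = S_x (T_y f(x + y))] needs no
    cut-off.  Associativity is then definitional, and commutativity, hence
    Fubini, is avoided except for the single identity
    [g * x = (t |-> \int g(s) x(t - s) ds)]. *)

Require Import Defs.
From Stdlib Require Import ClassicalEpsilon.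
From HB Require Import structures.
From mathcomp Require Import all_boot all_order all_algebra.
From mathcomp Require Import all_classical all_reals all_analysis.
From mathcomp Require Import measurable_realfun ring lra.
Set Implicit Arguments. Unset Strict Implicit. Unset Printing Implicit Defensive.
Import Order.TTheory GRing.Theory Num.Theory.
Import numFieldNormedType.Exports.
Local Open Scope classical_set_scope.
Local Open Scope ring_scope.

(** * Smooth functions and cut-offs *)

(** [conv] is an [epsilon] choice, so nothing is known about it until some functional is shown to
    satisfy [conv_rel], and [conv_rel] ranges over all support bounds and all cut-offs. The bridge
    is therefore that [rconv] satisfies [conv_rel], and that cut-offs exist, so that the relation
    fixes the value on every test function. All later identities are proved for [rconv] and carried
    back through [deq].

    The factor delta at [- Lam N] is forced: the kernel lives on [[0, Lam N]], whereas [Q] must be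
    supported in the negative half-line. The output delay compensates it exactly:
    [z = x (. - Lam N)] solves [Q * z = P * u]. The relation [DI_io] supplies the state [x], so
    condition (2) reduces to multiplying this equation by the inverse of [Q] on the left, that is,
    to one associativity. *)

Section smooth_functions.
Variable R : realType.
Implicit Types (f g : R -> R) (x c l C e h : R).

(** Avoids formulas for iterated derivatives: with a class stable under [derive1] as invariant, each
    smoothness proof below reduces to one first-order computation. *)
Lemma smooth_closed_class (S : set (R -> R)) :
    (forall f, S f -> forall x, derivable f x 1) ->
    (forall f, S f -> S (derive1 f)) ->
  forall f, S f -> smooth f.
Proof.
move=> dS cS f Sf n x; apply: dS.
elim: n => [|n IHn]; [by rewrite derive1n0|by rewrite derive1nS; exact: cS].
Qed.

(** The difference quotient is within [C * |h|] of [l]. This serves the two derivatives out of reach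
    of the calculus rules: [flat] at 0, and differentiation under a functional. *)
Lemma is_derive_quadratic_error f x l C e : 0 < e ->
  (forall h, `|h| < e -> `|f (x + h) - f x - h * l| <= C * h ^+ 2) ->
  is_derive x 1 f l.
Proof.
move=> e0 fC.
have cvl : h^-1 *: ((f \o shift x) (h *: 1) - f x) @[h --> 0^'] --> l.
  apply/cvgrPdist_le => eps eps0; near=> h.
  have h0 : h != 0 by near: h; exact: nbhs_dnbhs_neq.
  have he : `|h| < e by near: h; apply: dnbhs0_lt.
  have hC : `|h| <= eps / (`|C| + 1).
    by near: h; apply: dnbhs0_le; rewrite divr_gt0// ltr_pwDr.
  rewrite /= /GRing.scale /= mulr1 distrC.
  have -> : h^-1 * (f (h + x) - f x) - l = h^-1 * (f (x + h) - f x - h * l).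
    by rewrite (addrC h x) [RHS]mulrBr mulKf.
  rewrite normrM normfV ler_pdivrMl ?normr_gt0//.
  apply: (le_trans (fC _ he)); rewrite -[h ^+ 2]real_normK ?num_real// expr2.
  apply: (@le_trans _ _ (`|C| * (`|h| * `|h|))).
    by rewrite ler_wpM2r ?mulr_ge0// ler_norm.
  rewrite mulrCA ler_wpM2l//.
  rewrite ler_pdivlMr ?ltr_pwDr// in hC; apply: le_trans hC.
  by rewrite mulrC ler_wpM2l// lerDl.
by apply: DeriveDef; [apply/cvg_ex; exists l|exact: cvg_lim cvl].
Unshelve. all: by end_near. Qed.

Lemma smooth_derivable f x : smooth f -> derivable f x 1.
Proof. by move=> /(_ 0%N x); rewrite derive1n0. Qed.

Lemma smooth_derive1 f : smooth f -> smooth (derive1 f).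
Proof. by move=> sf n x; have := sf n.+1 x; rewrite /derive1n iterSr. Qed.

Lemma smooth_is_derive f x : smooth f -> is_derive x 1 f (derive1 f x).
Proof.
by move=> sf; rewrite derive1E; apply: DeriveDef => //; exact: smooth_derivable.
Qed.

Lemma smooth_continuous f : smooth f -> continuous f.
Proof.
by move=> sf x; apply/differentiable_continuous/derivable1_diffP/smooth_derivable.
Qed.

Lemma is_derive_derive1 f f' : (forall x, is_derive x 1 f (f' x)) ->
  derive1 f = f'.
Proof. by move=> ff'; apply/funext => x; rewrite derive1E; apply: derive_val. Qed.

Lemma is_derive_mulf f g x (a b : R) : is_derive x 1 f a -> is_derive x 1 g b ->
  is_derive x 1 (fun y => f y * g y) (a * g x + f x * b).
Proof.
move=> fa gb; have := is_deriveM fa gb; move/is_derive_eq; apply.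
by rewrite /GRing.scale/= addrC (mulrC a).
Qed.

Lemma is_derive_addf f g x (a b : R) : is_derive x 1 f a -> is_derive x 1 g b ->
  is_derive x 1 (fun y => f y + g y) (a + b).
Proof. by move=> fa gb; exact: is_deriveD. Qed.

Lemma is_derive_expf f n x (a : R) : is_derive x 1 f a ->
  is_derive x 1 (fun y => f y ^+ n) (n%:R * f x ^+ n.-1 * a).
Proof.
move=> fa; have -> : (fun y => f y ^+ n) = f ^+ n.
  by apply/funext => y; rewrite fctE.
exact: is_deriveX.
Qed.

Lemma smooth_cst c : smooth (fun _ : R => c).
Proof.
have dcst (b x : R) : is_derive x 1 (fun=> b) 0 by exact: is_derive_cst.
apply: (@smooth_closed_class [set f | exists b, f = fun=> b]); last by exists c.
- by move=> _ [b ->] x; apply: ex_derive.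
- by move=> _ [b ->]; exists 0; apply: is_derive_derive1.
Qed.

(** Sums are included because the Leibniz rule leaves the set of plain products. *)
Inductive product_span : (R -> R) -> Prop :=
| Product_span f g : smooth f -> smooth g -> product_span (fun x => f x * g x)
| Product_spanD f g : product_span f -> product_span g ->
    product_span (fun x => f x + g x).

Lemma product_span_derive f : product_span f ->
  exists2 f', product_span f' & forall x, is_derive x 1 f (f' x).
Proof.
elim=> {f} [f g sf sg|f g _ [f' sf' df'] _ [g' sg' dg']].
- exists (fun x => derive1 f x * g x + f x * derive1 g x).
    exact: (Product_spanD (Product_span (smooth_derive1 sf) sg)
                          (Product_span sf (smooth_derive1 sg))).
  by move=> x; apply: is_derive_mulf; exact: smooth_is_derive.
- exists (fun x => f' x + g' x); first exact: Product_spanD.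
  by move=> x; exact: is_derive_addf.
Qed.

Lemma product_span_smooth f : product_span f -> smooth f.
Proof.
apply: smooth_closed_class => {}f /product_span_derive[f' sf' ff'].
- by move=> x; apply: ex_derive.
- by rewrite (is_derive_derive1 ff').
Qed.

Lemma smoothM f g : smooth f -> smooth g -> smooth (fun x => f x * g x).
Proof. by move=> sf sg; apply: product_span_smooth; exact: Product_span. Qed.

Lemma smoothD f g : smooth f -> smooth g -> smooth (fun x => f x + g x).
Proof.
move=> sf sg.
have -> : (fun x => f x + g x) = (fun x => 1 * f x + 1 * g x).
  by apply/funext => x; rewrite !mul1r.
apply: product_span_smooth.
exact: (Product_spanD (Product_span (@smooth_cst 1) sf)
                      (Product_span (@smooth_cst 1) sg)).
Qed.

Lemma smoothZ c f : smooth f -> smooth (fun x => c * f x).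
Proof. by apply: smoothM; exact: smooth_cst. Qed.

Lemma is_derive_affine f (c d x l : R) : is_derive (c * x + d) 1 f l ->
  is_derive x 1 (fun y => f (c * y + d)) (c * l).
Proof.
move=> fl.
have dg : is_derive x 1 (fun y => c * y + d) c.
  have := is_derive_addf (is_derive_mulf (is_derive_cst c x 1)
    (is_derive_id x 1)) (is_derive_cst d x 1).
  by move/is_derive_eq; apply; rewrite mul0r add0r mulr1 addr0.
have := @is_derive1_comp R f (fun y => c * y + d) x l c fl dg.
by move/is_derive_eq; apply; rewrite mulrC.
Qed.

Lemma smooth_affine f (c d : R) : smooth f -> smooth (fun x => f (c * x + d)).
Proof.
move=> sf.
pose S := [set h | exists k g, smooth g /\ h = fun x => k * g (c * x + d)].
have dS (k : R) g x : smooth g ->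
    is_derive x 1 (fun y => k * g (c * y + d)) (k * c * derive1 g (c * x + d)).
  move=> sg; have := is_derive_mulf (is_derive_cst k x 1)
    (is_derive_affine (smooth_is_derive (c * x + d) sg)).
  by move/is_derive_eq; apply; rewrite mul0r add0r mulrA.
apply: (@smooth_closed_class S).
- by move=> _ [k [g [sg ->]]] x; have := dS k g x sg => ?; apply: ex_derive.
- move=> _ [k [g [sg ->]]]; exists (k * c), (derive1 g).
  split; first exact: smooth_derive1.
  by apply: is_derive_derive1 => x; exact: dS.
- by exists 1, f; split=> //; apply/funext => x; rewrite mul1r.
Qed.

Lemma smooth_shift f c : smooth f -> smooth (fun x => f (c + x)).
Proof.
move=> /(@smooth_affine _ 1 c); congr smooth; apply/funext => x.
by rewrite mul1r addrC.
Qed.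

Lemma smoothV g : smooth g -> (forall x, g x != 0) -> smooth (fun x => (g x)^-1).
Proof.
move=> sg g0.
(* Arbitrary numerators and powers are needed for stability: differentiating [f / g ^ n] gives
   [(f' g - n f g') / g ^ (n + 1)]. *)
pose S := [set h | exists f n, smooth f /\ h = fun x => f x * (g x)^-1 ^+ n].
have dS f n x : smooth f -> is_derive x 1 (fun y => f y * (g y)^-1 ^+ n)
    ((derive1 f x * g x + - n%:R * (f x * derive1 g x)) * (g x)^-1 ^+ n.+1).
  move=> sf.
  have dV := is_deriveV (g0 x) (smooth_is_derive x sg).
  have dX := is_derive_expf n dV.
  have := is_derive_mulf (smooth_is_derive x sf) dX.
  move/is_derive_eq; apply; rewrite /GRing.scale/=.
  case: n {dX} => [|n]; rewrite /= ?mulr1 ?mul0r ?mulr0 ?addr0 ?expr0 ?expr1.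
    by rewrite oppr0 mul0r addr0 mulfK// mulr1.
  rewrite -[in RHS]mulr_natr !exprS !exprVn; field.
  by rewrite g0 expf_neq0.
apply: (@smooth_closed_class S).
- by move=> _ [f [n [sf ->]]] x; have := dS f n x sf => ?; apply: ex_derive.
- move=> _ [f [n [sf ->]]].
  exists (fun x => derive1 f x * g x + - n%:R * (f x * derive1 g x)), n.+1.
  split; last by apply: is_derive_derive1 => x; exact: dS.
  exact: (smoothD (smoothM (smooth_derive1 sf) sg)
    (@smoothZ (- n%:R) _ (smoothM sf (smooth_derive1 sg)))).
- exists (cst 1), 1%N; split; first exact: smooth_cst.
  by apply/funext => x; rewrite mul1r.
Qed.

End smooth_functions.

Section cutoff.
Variable R : realType.
Implicit Types (x : R) (n : nat).

(* The linear span of these functions is closed under differentiation. *)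
Definition flat n x : R := if 0 < x then x^-1 ^+ n * expR (- x^-1) else 0.

Lemma flat_ge0 n x : 0 <= flat n x.
Proof.
rewrite /flat; case: ifPn => // x0.
by rewrite mulr_ge0 ?expR_ge0// exprn_ge0// invr_ge0 ltW.
Qed.

(** With [y = 1 / x], the exponential series gives [y ^ (n + 2) <= (n + 2)! e^y]. The two extra
    powers provide the quadratic error that yields derivative 0 at the origin. *)
Lemma flat_le_sqr n x : `|flat n x| <= n.+2`!%:R * x ^+ 2.
Proof.
rewrite /flat; case: ifPn => x0; last by rewrite normr0 mulr_ge0 ?sqr_ge0.
have y0 : 0 < x^-1 by rewrite invr_gt0.
rewrite ger0_norm; last by rewrite mulr_ge0 ?expR_ge0// exprn_ge0// ltW.
rewrite expRN ler_pdivrMr ?expR_gt0//.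
have := expR_ge1Dxn n.+1 (ltW y0); set y := x^-1 => ey.
have F0 : 0 < n.+2`!%:R :> R by rewrite ltr0n fact_gt0.
have {}ey : y ^+ n.+2 <= n.+2`!%:R * expR y.
  by rewrite mulrC -ler_pdivrMr//; apply: le_trans ey; rewrite lerDr.
have -> : y ^+ n = y ^+ n.+2 * x ^+ 2.
  rewrite -(addn2 n) exprD -mulrA -exprMn /y mulVf ?gt_eqF//.
  by rewrite expr1n mulr1.
by rewrite [leRHS]mulrAC ler_wpM2r ?sqr_ge0.
Qed.

Lemma is_derive_flat n x :
  is_derive x 1 (flat n) (- n%:R * flat n.+1 x + flat n.+2 x).
Proof.
have [x0|x0|->] := ltgtP x 0.
- have -> : - n%:R * flat n.+1 x + flat n.+2 x = 0.
    by rewrite /flat ltNge ltW//= mulr0 addr0.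
  apply: (near_eq_is_derive (f := cst 0)) => //.
  near=> y; rewrite /flat /cst/= ltNge ltW//=.
  by near: y; exact: lt_nbhsl.
- suff : is_derive x 1 (fun y : R => y^-1 ^+ n * expR (- y^-1))
      (- n%:R * flat n.+1 x + flat n.+2 x).
    apply: near_eq_is_derive; near=> y; rewrite /flat ifT//.
    by near: y; exact: lt_nbhsr.
  have dV := is_deriveV (lt0r_neq0 x0) (is_derive_id x 1).
  have dE := @is_derive1_comp _ expR (fun y : R => - y^-1) x _ _
    (is_derive_expR (- x^-1)) (is_deriveN dV).
  have := is_derive_mulf (is_derive_expf n dV) dE.
  move/is_derive_eq; apply; rewrite /flat x0 /GRing.scale/= !mulr1 opprK.
  case: n => [|n]; rewrite /= ?expr0 ?oppr0 ?mul0r ?mul1r ?add0r.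
    by rewrite exprVn mulrC.
  by rewrite !exprS !exprVn; field; rewrite ?expf_neq0 ?gt_eqF.
- rewrite {2 3}/flat ltxx mulr0 addr0.
  apply: (@is_derive_quadratic_error _ _ _ _ n.+2`!%:R 1) => // h _.
  by rewrite {2}/flat ltxx add0r mulr0 !subr0; exact: flat_le_sqr.
Unshelve. all: by end_near. Qed.

Inductive flat_span : (R -> R) -> Prop :=
| Flat_span (c : R) n : flat_span (fun x => c * flat n x)
| Flat_spanD f g : flat_span f -> flat_span g -> flat_span (fun x => f x + g x).

Lemma flat_span_derive f : flat_span f ->
  exists2 f', flat_span f' & forall x, is_derive x 1 f (f' x).
Proof.
elim=> {f} [c n|f g _ [f' sf' df'] _ [g' sg' dg']].
- exists (fun x => - (c * n%:R) * flat n.+1 x + c * flat n.+2 x).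
    exact: (Flat_spanD (Flat_span _ _) (Flat_span _ _)).
  move=> x; have := is_derive_mulf (is_derive_cst c x 1) (is_derive_flat n x).
  by move/is_derive_eq; apply; rewrite /cst; ring.
- exists (fun x => f' x + g' x); first exact: Flat_spanD.
  by move=> x; exact: is_derive_addf.
Qed.

Lemma smooth_flat n : smooth (flat n).
Proof.
have -> : flat n = fun x => 1 * flat n x by apply/funext => x; rewrite mul1r.
apply: (@smooth_closed_class _ flat_span); last exact: Flat_span.
- by move=> f /flat_span_derive[f' _ ff'] x; apply: ex_derive.
- by move=> f /flat_span_derive[f' sf' ff']; rewrite (is_derive_derive1 ff').
Qed.

Definition smooth_step x := flat 0 x / (flat 0 x + flat 0 (1 - x)).

Lemma smooth_step_den x : 0 < flat 0 x + flat 0 (1 - x).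
Proof.
have [x0|x0] := ltP 0 x.
  by rewrite ltr_pwDl ?flat_ge0// /flat x0 mul1r expR_gt0.
rewrite ltr_pwDr ?flat_ge0// /flat ifT ?mul1r ?expR_gt0//.
by rewrite subr_gt0 (le_lt_trans x0).
Qed.

Lemma smooth_smooth_step : smooth smooth_step.
Proof.
have s0 := @smooth_flat 0.
have s1 : smooth (fun x => flat 0 (1 - x)).
  move: (@smooth_affine _ (flat 0) (-1) 1 s0); congr smooth.
  by apply/funext => x; rewrite mulN1r addrC.
apply: (smoothM s0); apply: (smoothV (smoothD s0 s1)) => x.
by rewrite gt_eqF// smooth_step_den.
Qed.

Lemma smooth_step0 x : x <= 0 -> smooth_step x = 0.
Proof. by move=> x0; rewrite /smooth_step {1}/flat ltNge x0 mul0r. Qed.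

Lemma smooth_step1 x : 1 <= x -> smooth_step x = 1.
Proof.
move=> x1; have := smooth_step_den x; rewrite /smooth_step.
have -> : flat 0 (1 - x) = 0 by rewrite /flat ltNge subr_le0 x1.
by rewrite addr0 => f0; rewrite divff// gt_eqF.
Qed.

(** The product of a step rising on [[a - 1, a]] and a step falling on [[b, b + 1]]. *)
Lemma test_fun_cutoff (a b : R) :
  exists2 chi : R -> R, test_fun chi & forall x, a <= x <= b -> chi x = 1.
Proof.
have s1 : smooth (fun x => smooth_step (1 * x + (1 - a))).
  exact: (smooth_affine smooth_smooth_step).
have s2 : smooth (fun x => smooth_step (-1 * x + (b + 1))).
  exact: (smooth_affine smooth_smooth_step).
exists (fun x => smooth_step (1 * x + (1 - a)) * smooth_step (-1 * x + (b + 1))).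
  split; first exact: (smoothM s1 s2).
  exists (`|a| + `|b| + 1) => x; have := ler_norm b; have := ler_norm (- a).
  rewrite normrN; have := normr_ge0 a; have := normr_ge0 b.
  have [x0|x0] := ger0P x => b0 a0 ab bb K.
    by rewrite [X in _ * X]smooth_step0 ?mulr0//; lra.
  by rewrite smooth_step0 ?mul0r//; lra.
by move=> x /andP[ax xb]; rewrite !smooth_step1 ?mulr1//; lra.
Qed.

End cutoff.

(** * Measures as functionals, and their convolution *)

Section right_bounded_test_functions.
Variable R : realType.
Implicit Types (f g : R -> R) (x y a b c K M : R).

Definition vanish_gt K f := forall x, K < x -> f x = 0.

(** If [T] is carried by [[a, +oo[] and [f] has compact support, [x |-> T (f (x + .))] vanishes for
    large [x] but in general not for very negative [x]. Support bounded on the right is the property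
    that survives. *)
Definition rtest f := smooth f /\ exists K, vanish_gt K f.

Lemma test_fun_rtest f : test_fun f -> rtest f.
Proof.
by move=> [sf [K fK]]; split=> //; exists `|K| => x Kx; apply: fK;
  rewrite (le_lt_trans (ler_norm K))// (lt_le_trans Kx)// ler_norm.
Qed.

Lemma rtest_lin c f g : rtest f -> rtest g -> rtest (fun x => c * f x + g x).
Proof.
move=> [sf [K fK]] [sg [L gL]]; split; first exact: (smoothD (@smoothZ _ c _ sf) sg).
exists (Num.max K L) => x; rewrite gt_max => /andP[Kx Lx].
by rewrite fK// gL// mulr0 addr0.
Qed.

Lemma rtest0 : rtest (fun=> 0).
Proof. by split; [exact: smooth_cst|exists 0]. Qed.

Lemma rtestZ c f : rtest f -> rtest (fun x => c * f x).
Proof.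
move=> rf; have := rtest_lin c rf rtest0; congr rtest.
by apply/funext => x; rewrite addr0.
Qed.

Lemma rtestD f g : rtest f -> rtest g -> rtest (fun x => f x + g x).
Proof.
move=> rf rg; have := rtest_lin 1 rf rg; congr rtest.
by apply/funext => x; rewrite mul1r.
Qed.

Lemma rtestB f g : rtest f -> rtest g -> rtest (fun x => f x - g x).
Proof.
move=> rf rg; have := rtest_lin (-1) rg rf; congr rtest.
by apply/funext => x; rewrite mulN1r addrC.
Qed.

Lemma rtest_sum (I : Type) (r : seq I) (F : I -> R -> R) :
  (forall i, rtest (F i)) -> rtest (fun x => \sum_(i <- r) F i x).
Proof.
move=> rF; elim: r => [|i r IHr].
  by have := rtest0; congr rtest; apply/funext => x; rewrite big_nil.
by have := rtestD (rF i) IHr; congr rtest; apply/funext => x; rewrite big_cons.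
Qed.

Lemma vanish_gt_shift K x f :
  vanish_gt K f -> vanish_gt (K - x) (fun y => f (x + y)).
Proof. by move=> fK y; rewrite ltrBlDl => /fK. Qed.

Lemma vanish_gtW K L f : K <= L -> vanish_gt K f -> vanish_gt L f.
Proof. by move=> KL fK y Ly; apply: fK; exact: le_lt_trans Ly. Qed.

Lemma rtest_shift x f : rtest f -> rtest (fun y => f (x + y)).
Proof.
move=> [sf [K fK]]; split; first exact: smooth_shift.
by exists (K - x); exact: vanish_gt_shift.
Qed.

Lemma rtest_derive1 f : rtest f -> rtest (derive1 f).
Proof.
move=> [sf [K fK]]; split; first exact: smooth_derive1.
exists K => x Kx; rewrite derive1E.
rewrite (@near_eq_derive _ _ _ f (cst 0)) ?derive_cst//.
by near=> y; apply: fK; near: y; exact: lt_nbhsr.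
Unshelve. all: by end_near. Qed.

Lemma rtest_bounded f b : rtest f -> exists M, forall x, b <= x -> `|f x| <= M.
Proof.
move=> [sf [K fK]].
have [bK|Kb] := leP b K; last first.
  by exists 0 => x bx; rewrite fK ?normr0// (lt_le_trans Kb).
have cf : {within `[b, K], continuous (fun x => `|f x|)}.
  apply: continuous_subspaceT => x.
  by apply: continuous_comp; [exact: smooth_continuous|exact: norm_continuous].
have [c _ fc] := EVT_max bK cf.
exists `|f c| => x bx; have [xK|Kx] := leP x K; last by rewrite fK ?normr0.
by apply: fc; rewrite in_itv/= bx xK.
Qed.

Lemma smooth_MVT f x y : smooth f -> exists c, [/\ Num.min x y <= c,
  c <= Num.max x y & f y - f x = derive1 f c * (y - x)].
Proof.
move=> sf.
wlog xy : x y / x <= y.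
  move=> wl; have /orP[/wl//|/wl[c [mc cM fc]]] := le_total x y.
  exists c; rewrite minC maxC; split=> //.
  by rewrite -[LHS]opprB fc -mulrN opprB.
have [||c] := @MVT_segment _ f (derive1 f) x y xy.
- by move=> z _; exact: smooth_is_derive.
- by apply: continuous_subspaceT => z; exact: smooth_continuous.
- rewrite in_itv/= => /andP[xc cy] fc; exists c; split=> //.
    by rewrite ge_min xc.
  by rewrite le_max cy orbT.
Qed.

(** Two uses of the mean value theorem. The bound on the second derivative is asked only to the
    right of [x - |h|], since functions in [rtest] may be unbounded on the left. *)
Lemma smooth_Taylor f x h M : smooth f ->
  (forall y, x - `|h| <= y -> `|derive1 (derive1 f) y| <= M) ->
  `|f (x + h) - f x - h * derive1 f x| <= M * h ^+ 2.
Proof.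
move=> sf fM.
have [c [mc cM]] := smooth_MVT x (x + h) sf.
have [e [me eM]] := smooth_MVT x c (smooth_derive1 sf).
rewrite (addrC x h) addrK => fe fc.
rewrite fc mulrC -mulrBr fe normrM -[h ^+ 2]real_normK ?num_real//.
have h1 : - `|h| <= h by rewrite lerNl -normrN ler_norm.
have h2 := ler_norm h.
have cx : `|c - x| <= `|h|.
  rewrite ler_norml; move: mc cM; rewrite ge_min le_max => /orP mc /orP cM.
  have h0 := normr_ge0 h.
  by apply/andP; split; case: mc; case: cM => *; lra.
have Me : `|derive1 (derive1 f) e| <= M.
  apply: fM; apply: le_trans me; rewrite le_min; move: cx; rewrite ler_norml.
  by move=> /andP[cx _]; have h0 := normr_ge0 h; apply/andP; split; lra.
by rewrite [in leLHS]normrM expr2 [leRHS]mulrCA ler_wpM2l// ler_pM.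
Qed.

End right_bounded_test_functions.

Section order_zero_functionals.
Variable R : realType.
Local Notation pdistr := (pdistr R).
Implicit Types (f g : R -> R) (x y a b c K M : R) (S T : pdistr).

(* [T] is (integration against) a locally finite signed measure carried by
   [[a, +oo[]: taking [M = 0] in the second clause gives the support condition. *)
Definition rmeas a T : Prop :=
  (forall c f g, rtest f -> rtest g ->
    T (fun x => c * f x + g x) = c * T f + T g) /\
  (forall K, exists C : R, forall f M, rtest f -> vanish_gt K f ->
    (forall x, a <= x -> `|f x| <= M) -> `|T f| <= C * M).

Definition translates T f : R -> R := fun x => T (fun y => f (x + y)).

Definition rconv S T : pdistr := fun f => S (translates T f).

Lemma rmeas0 a T : rmeas a T -> T (fun=> 0) = 0.
Proof.
move=> [lT _]; have := lT (-1) _ _ (@rtest0 R) (@rtest0 R).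
have -> : (fun x : R => -1 * 0 + 0) = fun=> 0 :> R.
  by apply/funext => x; rewrite mulr0 addr0.
by rewrite mulN1r addNr.
Qed.

Lemma rmeasZ a T c f : rmeas a T -> rtest f -> T (fun x => c * f x) = c * T f.
Proof.
move=> mT rf; have := mT.1 c _ _ rf (@rtest0 R).
by rewrite (rmeas0 mT) addr0 => <-; congr T; apply/funext => x; rewrite addr0.
Qed.

Lemma rmeasD a T f g : rmeas a T -> rtest f -> rtest g ->
  T (fun x => f x + g x) = T f + T g.
Proof.
move=> mT rf rg; have := mT.1 1 _ _ rf rg.
by rewrite mul1r => <-; congr T; apply/funext => x; rewrite mul1r.
Qed.

Lemma rmeasB a T f g : rmeas a T -> rtest f -> rtest g ->
  T (fun x => f x - g x) = T f - T g.
Proof.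
move=> mT rf rg; have := mT.1 (-1) _ _ rg rf.
rewrite mulN1r addrC => <-; congr T.
by apply/funext => x; rewrite mulN1r addrC.
Qed.

Lemma rmeas_sum a T (I : Type) (r : seq I) (F : I -> R -> R) : rmeas a T ->
  (forall i, rtest (F i)) ->
  T (fun x => \sum_(i <- r) F i x) = \sum_(i <- r) T (F i).
Proof.
move=> mT rF; elim: r => [|i r IHr].
  rewrite big_nil -[RHS](rmeas0 mT); congr T.
  by apply/funext => x; rewrite big_nil.
rewrite big_cons -IHr -(rmeasD mT) //; last exact: rtest_sum.
by congr T; apply/funext => x; rewrite big_cons.
Qed.

Lemma rmeas_eq0 a T f : rmeas a T -> rtest f -> (forall x, a <= x -> f x = 0) ->
  T f = 0.
Proof.
move=> [_ bT] rf f0; have [_ [K fK]] := rf; have [C CT] := bT K.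
apply/eqP; rewrite -normr_le0 -(mulr0 C).
by apply: CT => // x /f0 ->; rewrite normr0.
Qed.

Lemma rmeas_eq a T f g : rmeas a T -> rtest f -> rtest g ->
  (forall x, a <= x -> f x = g x) -> T f = T g.
Proof.
move=> mT rf rg fg; apply/eqP; rewrite -subr_eq0 -(rmeasB mT rf rg); apply/eqP.
by apply: (rmeas_eq0 mT) => [|x /fg ->]; [exact: rtestB|rewrite subrr].
Qed.

Lemma rmeas_lin a c S T : rmeas a S -> rmeas a T ->
  rmeas a (fun f => c * S f + T f).
Proof.
move=> [lS bS] [lT bT]; split=> [e f g rf rg|K].
  by rewrite lS// lT//; ring.
have [C CS] := bS K; have [D DT] := bT K; exists (`|c| * C + D) => f M rf fK fM.
apply: (le_trans (ler_normD _ _)); rewrite mulrDl lerD ?DT//.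
by rewrite normrM -mulrA ler_wpM2l// CS.
Qed.

Lemma rmeas_zero a : rmeas a (fun=> 0).
Proof.
split=> [c f g _ _|K]; first by rewrite mulr0 addr0.
by exists 0 => f M _ _ _; rewrite normr0 mul0r.
Qed.

Lemma rmeas_scale a c T : rmeas a T -> rmeas a (fun f => c * T f).
Proof.
move=> mT; have := rmeas_lin c mT (@rmeas_zero a); congr rmeas.
by apply/funext => f; rewrite addr0.
Qed.

Lemma rmeas_add a S T : rmeas a S -> rmeas a T -> rmeas a (fun f => S f + T f).
Proof.
move=> mS mT; have := rmeas_lin 1 mS mT; congr rmeas.
by apply/funext => f; rewrite mul1r.
Qed.

Lemma rmeas_bigsum a (I : Type) (r : seq I) (T : I -> pdistr) :
  (forall i, rmeas a (T i)) -> rmeas a (fun f => \sum_(i <- r) T i f).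
Proof.
move=> mT; elim: r => [|i r IHr].
  have := @rmeas_zero a; congr rmeas.
  by apply/funext => f; rewrite big_nil.
have := rmeas_add (mT i) IHr; congr rmeas.
by apply/funext => f; rewrite big_cons.
Qed.

Lemma rmeas_dirac a c : a <= c -> rmeas a (fun f => f c).
Proof.
move=> ac; split=> // K; exists 1 => f M _ _ fM.
by rewrite mul1r; exact: fM.
Qed.

Lemma rmeas_shift a c T :
  rmeas a T -> rmeas (a + c) (fun f => T (fun x => f (c + x))).
Proof.
move=> [lT bT]; split=> [e f g rf rg|K].
  by rewrite lT//; exact: rtest_shift.
have [C CT] := bT (K - c); exists C => f M rf fK fM; apply: CT.
- exact: rtest_shift.
- exact: vanish_gt_shift.
- by move=> x ax; apply: fM; rewrite addrC lerD2l.
Qed.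

Lemma is_derive_translates a T f x : rmeas a T -> rtest f ->
  is_derive x 1 (translates T f) (translates T (derive1 f) x).
Proof.
move=> mT rf; have [sf [K fK]] := rf; have [lT bT] := mT.
have rf' := rtest_derive1 rf; have [_ [K' fK']] := rf'.
(* For [|h| < 1] and [y >= a], the Taylor remainder at [x + y] sees the second derivative only to
   the right of [a + x - 1], and it vanishes for [y > max K K' - x + 1]. Hence one [M] and one [C]
   serve all these [h]. *)
have [M fM] := rtest_bounded (a + x - 1) (rtest_derive1 rf').
have [C CT] := bT (Num.max K K' - x + 1).
apply: (@is_derive_quadratic_error _ _ _ _ (C * M) 1) => // h h1.
have rx := rtest_shift x rf; have rxh := rtest_shift (x + h) rf.
have rx' := rtest_shift x rf'; have rh := rtestB rxh rx.
have -> : translates T f (x + h) - translates T f x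
    - h * translates T (derive1 f) x =
    T (fun y => (f (x + h + y) - f (x + y)) - h * derive1 f (x + y)).
  by rewrite (rmeasB mT rh (rtestZ h rx')) (rmeasZ _ mT rx') (rmeasB mT rxh rx).
rewrite -mulrA; apply: CT.
- exact: (rtestB rh (rtestZ h rx')).
- move=> y; have KK : K <= Num.max K K' by rewrite le_max lexx.
  have KK' : K' <= Num.max K K' by rewrite le_max lexx orbT.
  move: h1; rewrite ltr_norml => /andP[h1 h2] Ky.
  by rewrite !fK ?fK' ?mulr0 ?subr0//; lra.
- move=> y ay; have -> : x + h + y = x + y + h by rewrite addrAC.
  apply: smooth_Taylor => // z xyz; apply: fM; apply: le_trans xyz.
  by have := ltW h1; lra.
Qed.

Lemma vanish_translates a T K f : rmeas a T -> rtest f -> vanish_gt K f ->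
  vanish_gt (K - a) (translates T f).
Proof.
move=> mT rf fK x Kx; apply: (rmeas_eq0 mT); first exact: rtest_shift.
by move=> y ay; apply: fK; lra.
Qed.

Lemma rtest_translates a T f : rmeas a T -> rtest f -> rtest (translates T f).
Proof.
move=> mT rf; split; last first.
  by have [_ [K fK]] := rf; exists (K - a); exact: vanish_translates.
apply: (@smooth_closed_class _ [set translates T g | g in @rtest R]).
- move=> _ [g rg <-] x; have := is_derive_translates x mT rg.
  by move=> dg; exact: ex_derive.
- move=> _ [g rg <-]; exists (derive1 g); first exact: rtest_derive1.
  apply/esym/is_derive_derive1 => x; exact: (is_derive_translates x mT rg).
- by exists f.
Qed.

Lemma translates_lin a T c f g : rmeas a T -> rtest f -> rtest g ->
  translates T (fun x => c * f x + g x) =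
  fun x => c * translates T f x + translates T g x.
Proof.
by move=> [lT _] rf rg; apply/funext => x; rewrite /translates lT//;
  exact: rtest_shift.
Qed.

Lemma rmeas_conv a b S T : rmeas a S -> rmeas b T -> rmeas (a + b) (rconv S T).
Proof.
move=> mS mT; split=> [c f g rf rg|K].
  by rewrite /rconv (translates_lin _ mT)// mS.1//; exact: (rtest_translates mT).
have [C CS] := mS.2 (K - b); have [D DT] := mT.2 (K - a).
exists (C * D) => f M rf fK fM; rewrite -mulrA; apply: CS.
- exact: (rtest_translates mT).
- exact: vanish_translates.
- move=> x ax; apply: DT; first exact: rtest_shift.
    by apply: vanish_gtW (vanish_gt_shift fK); rewrite lerD2l lerN2.
  by move=> y yb; apply: fM; exact: lerD.
Qed.

End order_zero_functionals.

(** * Agreement of [rconv] with the cut-off convolution on test functions *)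

Section distributions.
Variable R : realType.
Local Notation pdistr := (pdistr R).
Implicit Types (phi : R -> R) (a b K : R) (S T : pdistr).

Lemma test_fun_mull (chi f : R -> R) : test_fun chi -> smooth f ->
  test_fun (fun x => chi x * f x).
Proof.
move=> [sc [K cK]] sf; split; first exact: smoothM.
by exists K => x /cK ->; rewrite mul0r.
Qed.

Lemma test_fun_lin (c : R) (f g : R -> R) : test_fun f -> test_fun g ->
  test_fun (fun x => c * f x + g x).
Proof.
move=> tf tg; have [sf [K fK]] := tf; have [sg [L gL]] := tg.
split; first exact: (smoothD (@smoothZ _ c _ sf) sg).
exists (Num.max K L) => x; rewrite gt_max => /andP[/fK -> /gL ->].
by rewrite mulr0 addr0.
Qed.

Lemma test_fun_shift x phi : test_fun phi -> test_fun (fun y => phi (x + y)).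
Proof.
move=> [sf [K fK]]; split; first exact: smooth_shift.
exists (K + `|x|) => y Ky; apply: fK.
have yx : `|y| <= `|x + y| + `|x|.
  by rewrite -{1}(addKr x y) (le_trans (ler_normD _ _))// normrN addrC.
lra.
Qed.

Lemma supported_vanish_gt K phi : supported_in K phi -> vanish_gt K phi.
Proof. by move=> fK x Kx; apply: fK; rewrite (lt_le_trans Kx)// ler_norm. Qed.

Lemma rmeas_order_zero a T : rmeas a T -> order_zero T.
Proof.
move=> [_ bT] K; have [C CT] := bT K; exists C => phi M tphi sphi phiM.
by apply: CT => //; [exact: test_fun_rtest|exact: supported_vanish_gt].
Qed.

Lemma rmeas_is_distr a T : rmeas a T -> is_distr T.
Proof.
move=> [lT bT]; split=> [c f g tf tg|K].
  by apply: lT; exact: test_fun_rtest.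
have [C CT] := bT K; exists 0%N, C => phi M tphi sphi phiM.
rewrite big_nat1; apply: CT; first exact: test_fun_rtest.
  exact: supported_vanish_gt.
by move=> x _; have := phiM 0%N x (leqnn 0); rewrite derive1n0.
Qed.

Lemma rmeas_supp_ge a T : rmeas a T -> supp_ge a T.
Proof.
move=> mT phi tphi [e [e0 phie]]; apply: (rmeas_eq0 mT).
  exact: test_fun_rtest.
by move=> x ax; apply: phie; lra.
Qed.

Lemma rmeas_in_Dplus a T : rmeas a T -> in_Dplus T.
Proof.
move=> mT; split; first exact: rmeas_is_distr mT.
by exists a; exact: rmeas_supp_ge.
Qed.

Lemma supp_ge_deq a S T : deq S T -> supp_ge a S -> supp_ge a T.
Proof. by move=> ST sS phi tphi phi0; rewrite -ST//; exact: sS. Qed.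

(** The bounds [a'], [b'] and the cut-off [chi] are arbitrary, unrelated to [a] and [b]. A second
    cut-off [chi2], equal to 1 far enough to the left for both [a] and [a'], mediates:
    [S0 h = S0 (chi2 h)] because [S0] is carried by [[a, +oo[], and [(chi - chi2) h] vanishes near
    [[a', +oo[]. *)
Lemma conv_rel_rconv a b S T S0 T0 : rmeas a S0 -> rmeas b T0 ->
  deq S S0 -> deq T T0 -> conv_rel S T (rconv S0 T0).
Proof.
move=> mS mT SS TT a' b' K phi chi sS sT tphi phiK tchi chi1.
have {sS} sS := supp_ge_deq SS sS; have {sT} sT := supp_ge_deq TT sT.
have rphi := test_fun_rtest tphi.
have -> : (fun x => chi x * T (fun y => phi (x + y))) =
    (fun x => chi x * translates T0 phi x).
  by apply/funext => x; rewrite TT//; exact: test_fun_shift.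
set h := translates T0 phi.
have rh : rtest h by exact: (rtest_translates mT).
have th c : test_fun c -> test_fun (fun x => c x * h x).
  by move=> tc; apply: test_fun_mull => //; exact: rh.1.
(* Since [b'] may exceed [b], this uses the distributional support of [T0], with half of the gap as
   margin. *)
have hK x : K - b' < x -> h x = 0.
  move=> Kx; apply: sT; first exact: test_fun_shift.
  exists ((x - (K - b')) / 2); split; first by lra.
  by move=> y xy; apply: (supported_vanish_gt phiK); lra.
have [chi2 tchi2 chi21] := test_fun_cutoff (Num.min a a' - 1) (K - b' + 1).
have ma : Num.min a a' <= a by rewrite ge_min lexx.
have ma' : Num.min a a' <= a' by rewrite ge_min lexx orbT.
rewrite SS; last exact: th.
rewrite /rconv -/h (@rmeas_eq _ a S0 h (fun x => chi2 x * h x))//; last 2 first.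
- exact/test_fun_rtest/th.
- move=> x ax; have [xK|Kx] := leP x (K - b'); last by rewrite hK// mulr0.
  by rewrite chi21 ?mul1r//; apply/andP; split; lra.
apply/eqP; rewrite -subr_eq0.
rewrite -(rmeasB mS); try exact/test_fun_rtest/th.
apply/eqP; apply: sS.
  have := test_fun_lin (-1) (th _ tchi) (th _ tchi2); congr test_fun.
  by apply/funext => x; rewrite mulN1r addrC.
exists (1 / 2); split; first by lra.
move=> x ax; have [xK|Kx] := leP x (K - b'); last by rewrite hK// !mulr0 subrr.
by rewrite chi21 ?chi1 ?subrr//; apply/andP; split; lra.
Qed.

(** The witness [rconv S0 T0] makes the [epsilon] choice satisfy [conv_rel]; a single admissible
    cut-off then forces both functionals to the same value at [phi]. *)
Lemma conv_rconv a b S T S0 T0 : rmeas a S0 -> rmeas b T0 ->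
  deq S S0 -> deq T T0 -> deq (Defs.conv S T) (rconv S0 T0).
Proof.
move=> mS mT SS TT phi tphi.
have cST := conv_rel_rconv mS mT SS TT.
have cU : conv_rel S T (Defs.conv S T).
  by apply: epsilon_spec; exists (rconv S0 T0).
have [_ [K phiK]] := tphi.
have [chi tchi chi1] := test_fun_cutoff (a - 1) (K - b + 1).
have sS : supp_ge a S.
  by apply: supp_ge_deq (rmeas_supp_ge mS) => ? ?; rewrite SS.
have sT : supp_ge b T.
  by apply: supp_ge_deq (rmeas_supp_ge mT) => ? ?; rewrite TT.
rewrite (cU _ _ _ _ _ sS sT tphi phiK tchi chi1).
by rewrite (cST _ _ _ _ _ sS sT tphi phiK tchi chi1).
Qed.

End distributions.

(** * Matrices of measures and the Neumann series *)

Section functional_matrices.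
Variable R : realType.
Implicit Types (f : R -> R) (a b : R).

Definition mconv n p r (S : dmx R n p) (T : dmx R p r) : dmx R n r :=
  fun i j f => \sum_k rconv (S i k) (T k j) f.

Definition mrmeas n p a (S : dmx R n p) := forall i j, rmeas a (S i j).

Lemma mrmeas_conv n p r a b (S : dmx R n p) (T : dmx R p r) :
  mrmeas a S -> mrmeas b T -> mrmeas (a + b) (mconv S T).
Proof. by move=> mS mT i j; apply: rmeas_bigsum => k;
  exact: (rmeas_conv (mS i k) (mT k j)). Qed.

Lemma mconvA n p r s a b c (S : dmx R n p) (T : dmx R p r) (U : dmx R r s) i j f :
  mrmeas a S -> mrmeas b T -> mrmeas c U -> rtest f ->
  mconv (mconv S T) U i j f = mconv S (mconv T U) i j f.
Proof.
move=> mS mT mU rf; rewrite /mconv {1}/rconv exchange_big/=.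
apply: eq_bigr => k _.
rewrite /rconv /translates -(rmeas_sum _ (mS i k)); last first.
  by move=> l; exact: (rtest_translates (mT k l) (rtest_translates (mU l j) rf)).
congr (S i k); apply/funext => x; apply: eq_bigr => l _.
congr (T k l); apply/funext => y; congr (U l j); apply/funext => z.
by rewrite addrA.
Qed.

Lemma eq_mconvr n p r (S : dmx R n p) (T U : dmx R p r) i j f : rtest f ->
  (forall k g, rtest g -> T k j g = U k j g) -> mconv S T i j f = mconv S U i j f.
Proof.
move=> rf TU; apply: eq_bigr => k _; congr (S i k); apply/funext => x.
by apply: TU; exact: rtest_shift.
Qed.

Lemma eq_mconvl n p r a (S U : dmx R n p) (T : dmx R p r) i j f : rtest f ->
  mrmeas a T -> (forall k g, rtest g -> S i k g = U i k g) ->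
  mconv S T i j f = mconv U T i j f.
Proof.
move=> rf mT SU; apply: eq_bigr => k _.
by apply: SU; exact: (rtest_translates (mT k j)).
Qed.

Definition mdelta n : dmx R n n := fun i j f => (i == j)%:R * f 0.

Lemma mrmeas_delta n : mrmeas 0 (@mdelta n).
Proof. by move=> i j; apply/rmeas_scale/rmeas_dirac. Qed.

Lemma mconv_deltal n p (T : dmx R n p) i j f : mconv (@mdelta n) T i j f = T i j f.
Proof.
rewrite /mconv (bigD1 i)//= big1 => [|k ki].
  rewrite /rconv /mdelta /translates eqxx mul1r addr0; congr (T i j).
  by apply/funext => y; rewrite add0r.
by rewrite /rconv /mdelta eq_sym (negPf ki) mul0r.
Qed.

Lemma mconv_deltar a n p (T : dmx R n p) i j f : mrmeas a T -> rtest f ->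
  mconv T (@mdelta p) i j f = T i j f.
Proof.
move=> mT rf; rewrite /mconv (bigD1 j)//= big1 => [|k kj].
  rewrite /rconv /mdelta /translates eqxx addr0; congr (T i j).
  by apply/funext => y; rewrite mul1r addr0.
rewrite /rconv /mdelta /translates (negPf kj) -[RHS](rmeas0 (mT i k)).
by congr (T i k); apply/funext => x; rewrite mul0r.
Qed.

Lemma big_daddE (I : Type) (r : seq I) (P : pred I) (T : I -> pdistr R) f :
  (\big[@Defs.dadd R/@dzero R]_(i <- r | P i) T i) f = \sum_(i <- r | P i) T i f.
Proof. exact: (big_morph (fun S : pdistr R => S f)). Qed.

Lemma dmx_conv_mconv n p r a b (M M0 : dmx R n p) (N N0 : dmx R p r) :
  mrmeas a M0 -> mrmeas b N0 -> dmx_eq M M0 -> dmx_eq N N0 ->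
  dmx_eq (dmx_conv M N) (mconv M0 N0).
Proof.
move=> mM mN MM NN i j phi tphi; rewrite /dmx_conv big_daddE.
by apply: eq_bigr => k _; exact: (conv_rconv (mM i k) (mN k j)).
Qed.

(** Iterated [conv] products are known only up to [deq], so the invariant is [rep], agreement with
    some [rmeas] on test functions, which [conv_rconv] propagates. The signed sum over permutations
    is then bounded for each fixed [K]. *)
Lemma dmx_det_order_zero n a (M : dmx R n n) :
  mrmeas a M -> order_zero (dmx_det M).
Proof.
move=> mM.
pose rep (T : pdistr R) := exists b T0, rmeas b T0 /\ deq T T0.
have rep_prod (s : 'I_n -> 'I_n) :
    rep (\big[@Defs.conv R/@delta0 R]_(i < n) M i (s i)).
  apply: (big_ind rep).
  - by exists 0, (@delta0 R); split=> //; exact: rmeas_dirac.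
  - move=> S T [b [S0 [mS SS]]] [c [T0 [mT TT]]].
    exists (b + c), (rconv S0 T0); split; first exact: rmeas_conv.
    exact: (conv_rconv mS mT SS TT).
  - by move=> i _; exists a, (M i (s i)).
rewrite /dmx_det => K.
pose bounded (T : pdistr R) := exists C : R, forall (phi : R -> R) (M : R),
  test_fun phi -> supported_in K phi -> (forall x, `|phi x| <= M) ->
  `|T phi| <= C * M.
apply: (big_ind bounded).
- by exists 0 => phi L _ _ _; rewrite normr0 mul0r.
- move=> S T [C CS] [D DT]; exists (C + D) => phi L tphi sphi phiL.
  by rewrite mulrDl (le_trans (ler_normD _ _))// lerD ?CS ?DT.
- move=> s _; set T := (X in Defs.dscale _ X).
  have [b [T0 [mT TT]]] : rep T by exact: rep_prod.
  have [C CT] := rmeas_order_zero mT K.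
  exists C => phi L tphi sphi phiL; rewrite /Defs.dscale normrM normrX normrN1.
  by rewrite expr1n mul1r TT//; exact: CT.
Qed.

End functional_matrices.

Section neumann_series.
Variables (R : realType) (d : nat) (k : dmx R d d) (lam c : R).
Implicit Types (f : R -> R) (M : R) (n : nat).

(* A bound [`|T f| <= C M] for all such [f] says that [e^(-lam t)] has integral
   at most [C] against the variation of [T], a submultiplicative norm. *)
Definition wbound M f := forall x, 0 <= x -> `|f x| <= M * expR (- (lam * x)).

Hypotheses (lam0 : 0 <= lam) (dc : d%:R * c <= 2^-1).
Hypothesis mk : mrmeas 0 k.
Hypothesis wk : forall i j f M, rtest f -> wbound M f -> `|k i j f| <= c * M.

Lemma wbound_ge0 M f : wbound M f -> 0 <= M.
Proof.
move=> /(_ 0 (lexx _))/(le_trans (normr_ge0 _)).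
by rewrite mulr0 oppr0 expR0 mulr1.
Qed.

Lemma wbound_shift M f x : 0 <= x -> wbound M f ->
  wbound (M * expR (- (lam * x))) (fun y => f (x + y)).
Proof.
move=> x0 fM y y0; rewrite -mulrA -expRD -opprD -mulrDr.
by apply: fM; exact: addr_ge0.
Qed.

Lemma vanish_gt_wbound K M f : vanish_gt K f -> (forall x, 0 <= x -> `|f x| <= M) ->
  wbound (M * expR (lam * `|K|)) f.
Proof.
move=> fK fM x x0; have M0 : 0 <= M by exact: le_trans (fM _ x0).
have [xK|Kx] := leP x K; last by rewrite fK// normr0 !mulr_ge0 ?expR_ge0.
apply: (le_trans (fM _ x0)); rewrite -mulrA -expRD ler_peMr//.
by rewrite -expR0 ler_expR -mulrBr mulr_ge0// subr_ge0 (le_trans xK)// ler_norm.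
Qed.

Lemma rtest_wbound f : rtest f -> exists M, wbound M f.
Proof.
move=> rf; have [_ [K fK]] := rf; have [M fM] := rtest_bounded 0 rf.
by exists (M * expR (lam * `|K|)); exact: vanish_gt_wbound.
Qed.

Fixpoint kpow n : dmx R d d := if n is m.+1 then mconv k (kpow m) else @mdelta R d.

Lemma mrmeas_kpow n : mrmeas 0 (kpow n).
Proof.
elim: n => [|n IHn] /=; first exact: mrmeas_delta.
by rewrite -[0]addr0; exact: mrmeas_conv.
Qed.

(** A matrix product adds [d] entries; [dc] is what makes each row contract by 1/2. *)
Lemma sum_le_half (F : 'I_d -> R) M : 0 <= M -> (forall i, F i <= c * M) ->
  \sum_i F i <= M / 2.
Proof.
move=> M0 FM; apply: (@le_trans _ _ (\sum_(i < d) c * M)); first exact: ler_sum.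
by rewrite sumr_const card_ord -[leLHS]mulr_natl mulrA [leRHS]mulrC ler_wpM2r.
Qed.

(** Shifting the argument by [x] multiplies the bound by [e^(- lam x)], so
    [translates (kpow n l j) f] is again weighted-bounded, by [M / 2 ^+ n], and one more factor [k]
    halves this. *)
Lemma kpow_bound n i j f M : rtest f -> wbound M f -> `|kpow n i j f| <= M / 2 ^+ n.
Proof.
elim: n i j f M => [|n IHn] i j f M rf fM.
  rewrite expr0 divr1 /kpow /mdelta normrM.
  have := fM 0 (lexx _); rewrite mulr0 oppr0 expR0 mulr1; apply: le_trans.
  by case: (i == j); rewrite ?normr1 ?normr0 ?mul1r ?mul0r.
rewrite exprS invfM mulrA mulrAC; apply: (le_trans (ler_norm_sum _ _ _)).
apply: sum_le_half => [|l]; first by rewrite divr_ge0 ?exprn_ge0 ?(wbound_ge0 fM).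
apply: wk; first exact: (rtest_translates (mrmeas_kpow n l j)).
move=> x x0; rewrite mulrAC; apply: IHn; first exact: rtest_shift.
exact: wbound_shift.
Qed.

Lemma kpowSr n i j f : rtest f -> kpow n.+1 i j f = mconv (kpow n) k i j f.
Proof.
elim: n i j f => [|n IHn] i j f rf.
  by rewrite mconv_deltal /= (mconv_deltar _ _ mk).
rewrite /= (mconvA _ _ mk (mrmeas_kpow n) mk rf).
by apply: eq_mconvr => // l g rg; exact: IHn.
Qed.

(** Replaces passages to the limit: identities for the series are checked on partial sums, up to an
    error of this form. *)
Lemma halves_eq0 (A x : R) : (forall n, `|x| <= A / 2 ^+ n) -> x = 0.
Proof.
move=> xA; apply/eqP; rewrite -normr_le0 leNgt; apply/negP => x0.
have [n An] : exists n : nat, A / `|x| < n%:R.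
  exists (Num.truncn (`|A / `|x| |)).+1.
  by rewrite (le_lt_trans (ler_norm _))// truncnS_gt.
have := xA n; rewrite ler_pdivlMr ?exprn_gt0// leNgt => /negP; apply.
rewrite ltr_pdivrMr// in An; apply: (lt_le_trans An).
by rewrite mulrC ler_wpM2l// -natrX ler_nat ltnW// ltn_expl.
Qed.

Definition neumann : dmx R d d :=
  fun i j f => limn (series (fun n => kpow n i j f)).

Lemma geometric_series_tail (u : nat -> R) M : 0 <= M ->
  (forall n, `|u n| <= M / 2 ^+ n) ->
  forall n, `|limn (series u) - \sum_(m < n) u m| <= 2 * M / 2 ^+ n.
Proof.
move=> M0 uM n.
(* Subtracting the tail that remains after [n + m] lets the induction close with equality of the
   bounds. *)
have tail m : `|series u (n + m)%N - series u n| <=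
    2 * M / 2 ^+ n - 2 * M / 2 ^+ (n + m).
  elim: m => [|m IHm]; first by rewrite addn0 !subrr normr0.
  rewrite addnS; have -> : series u (n + m).+1 - series u n =
      u (n + m)%N + (series u (n + m)%N - series u n).
    by rewrite /series/= big_nat_recr//=; ring.
  apply: (le_trans (ler_normD _ _)); apply: (le_trans (lerD (uM _) IHm)).
  rewrite exprS le_eqVlt; apply/orP; left; apply/eqP; field.
  by rewrite !expf_neq0.
have cu : cvgn (series u).
  apply: normed_cvg; apply: (@series_le_cvg _ _ (geometric M 2^-1)).
  - by move=> m; exact: normr_ge0.
  - by move=> m; rewrite /geometric/= mulr_ge0// exprn_ge0// invr_ge0.
  - by move=> m; rewrite /geometric/= exprVn.
  - by apply: is_cvg_geometric_series; rewrite ger0_norm; lra.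
have -> : \sum_(m < n) u m = series u n by rewrite /series/= big_mkord.
have : (fun m => `|series u (n + m)%N - series u n|) @ \oo -->
    `|limn (series u) - series u n|.
  apply: cvg_norm; apply: cvgB; last exact: cvg_cst.
  have -> : (fun m => series u (n + m)%N) = (fun m => series u (m + n)%N).
    by apply/funext => m; rewrite addnC.
  by rewrite (cvg_shiftn n (series u)).
move=> cl; rewrite -(cvg_lim _ cl)//; apply: limr_le.
  by apply/cvg_ex; exists (`|limn (series u) - series u n|).
near=> m; apply: (le_trans (tail m)).
by rewrite gerBl divr_ge0 ?mulr_ge0 ?exprn_ge0.
Unshelve. all: by end_near. Qed.

Lemma neumann_tail n i j f M : rtest f -> wbound M f ->
  `|neumann i j f - \sum_(m < n) kpow m i j f| <= 2 * M / 2 ^+ n.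
Proof.
move=> rf fM; apply: geometric_series_tail; first exact: wbound_ge0 fM.
by move=> m; exact: kpow_bound.
Qed.

Lemma mrmeas_neumann : mrmeas 0 neumann.
Proof.
move=> i j; split=> [e f g rf rg|K].
  have rh := rtest_lin e rf rg.
  have [Mf fM] := rtest_wbound rf; have [Mg gM] := rtest_wbound rg.
  have [Mh hM] := rtest_wbound rh.
  apply/eqP; rewrite -subr_eq0; apply/eqP.
  apply: (@halves_eq0 (2 * Mh + (`|e| * (2 * Mf) + 2 * Mg))) => n.
  have tf := neumann_tail n i j rf fM; have tg := neumann_tail n i j rg gM.
  have th := neumann_tail n i j rh hM; move: tf tg th.
  have -> : \sum_(m < n) kpow m i j (fun x => e * f x + g x) =
      e * \sum_(m < n) kpow m i j f + \sum_(m < n) kpow m i j g.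
    rewrite mulr_sumr -big_split/=; apply: eq_bigr => m _.
    exact: (mrmeas_kpow m i j).1.
  set sf := \sum_(m < n) _; set sg := \sum_(m < n) _ => tf tg th.
  set x := neumann i j _ in th *; set y := neumann i j f in tf *.
  set z := neumann i j g in tg *.
  have -> : x - (e * y + z) =
      (x - (e * sf + sg)) - (e * (y - sf) + (z - sg)) by ring.
  rewrite mulrDl (le_trans (ler_normB _ _))// lerD// mulrDl.
  rewrite (le_trans (ler_normD _ _))// lerD//.
  by rewrite normrM -mulrA ler_wpM2l.
(* The tail after zero terms is the whole series, whence the 2; the exponential turns a plain bound
   on a function vanishing beyond [K] into a weighted one. *)
exists (2 * expR (lam * `|K|)) => f M rf fK fM.
have := neumann_tail 0 i j rf (vanish_gt_wbound fK fM).
by rewrite big_ord0 subr0 expr0 divr1 (mulrC M) mulrA.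
Qed.

(** Here [k] acts on [f] first, giving the fixed functions [translates (k l j) f]; the tail estimate
    applies to each with its own bound [Ml l]. *)
Lemma neumannr i j f : rtest f ->
  neumann i j f = mdelta i j f + mconv neumann k i j f.
Proof.
move=> rf; have [M fM] := rtest_wbound rf.
have rl l : rtest (translates (k l j) f) by exact: (rtest_translates (mk l j)).
have [Ml lM] := choice (fun l => rtest_wbound (rl l)).
apply/eqP; rewrite -subr_eq0; apply/eqP.
apply: (@halves_eq0 (M + \sum_l 2 * Ml l)) => n.
(* One more term than in [tl], because the first one is [mdelta]; the error [2 * M / 2 ^+ n.+1] is
   [M / 2 ^+ n]. *)
have tf := neumann_tail n.+1 i j rf fM.
have tl : `|mconv neumann k i j f - \sum_(m < n) mconv (kpow m) k i j f| <=
    (\sum_l 2 * Ml l) / 2 ^+ n.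
  rewrite exchange_big/= -sumrB mulr_suml (le_trans (ler_norm_sum _ _ _))//.
  by apply: ler_sum => l _; exact: neumann_tail.
have eS : \sum_(m < n.+1) kpow m i j f =
    mdelta i j f + \sum_(m < n) mconv (kpow m) k i j f.
  by rewrite big_ord_recl; congr (_ + _); apply: eq_bigr => m _; exact: kpowSr.
rewrite eS in tf; move: tf tl; set s := \sum_(m < n) _ => tf tl.
set x := neumann i j f in tf *; set y := mconv _ _ _ _ _ in tl *.
have -> : x - (mdelta i j f + y) = (x - (mdelta i j f + s)) - (y - s) by ring.
rewrite mulrDl (le_trans (ler_normB _ _))// lerD//.
by apply: (le_trans tf); rewrite exprS invfM mulrA (mulrC 2) mulfK.
Qed.

(** Here [k] acts on the tail seen as a function of the shift [x]. By [wbound_shift] that function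
    is weighted-bounded by [2 * M / 2 ^+ n], so [wk] applies to it. *)
Lemma neumannl i j f : rtest f ->
  neumann i j f = mdelta i j f + mconv k neumann i j f.
Proof.
move=> rf; have [M fM] := rtest_wbound rf; have M0 := wbound_ge0 fM.
apply/eqP; rewrite -subr_eq0; apply/eqP.
apply: (@halves_eq0 (M + M)) => n.
have tf := neumann_tail n.+1 i j rf fM.
have rE m l : rtest (translates (kpow m l j) f).
  exact: (rtest_translates (mrmeas_kpow m l j)).
have rN l : rtest (translates (neumann l j) f).
  exact: (rtest_translates (mrmeas_neumann l j)).
have tl : `|mconv k neumann i j f - \sum_(m < n) mconv k (kpow m) i j f| <=
    M / 2 ^+ n.
  rewrite exchange_big/= -sumrB (le_trans (ler_norm_sum _ _ _))//.
  have -> : M / 2 ^+ n = (2 * M / 2 ^+ n) / 2 by field; rewrite expf_neq0.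
  apply: sum_le_half => [|l]; first by rewrite divr_ge0 ?mulr_ge0 ?exprn_ge0.
  rewrite -(rmeas_sum _ (mk i l)) => [|m]; last exact: rE.
  have rS : rtest (fun x => \sum_(m < n) translates (kpow m l j) f x).
    by apply: rtest_sum => m; exact: rE.
  rewrite /rconv -(rmeasB (mk i l) (rN l) rS); apply: wk; first exact: rtestB.
  move=> x x0; have -> : 2 * M / 2 ^+ n * expR (- (lam * x)) =
    2 * (M * expR (- (lam * x))) / 2 ^+ n by ring.
  by apply: neumann_tail; [exact: rtest_shift|exact: wbound_shift].
have eS : \sum_(m < n.+1) kpow m i j f =
    mdelta i j f + \sum_(m < n) mconv k (kpow m) i j f.
  by rewrite big_ord_recl.
rewrite eS in tf; move: tf tl; set s := \sum_(m < n) _ => tf tl.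
set x := neumann i j f in tf *; set y := mconv _ _ _ _ _ in tl *.
have -> : x - (mdelta i j f + y) = (x - (mdelta i j f + s)) - (y - s) by ring.
rewrite mulrDl (le_trans (ler_normB _ _))// lerD//.
by apply: (le_trans tf); rewrite exprS invfM mulrA (mulrC 2) mulfK.
Qed.

End neumann_series.

(** * Locally integrable functions as measures *)

Section lebesgue_invariance.
Variable R : realType.
Local Notation mu := (@lebesgue_measure R).
Implicit Types (c : R) (A : set R).

Lemma aeS (P Q : R -> Prop) : (forall x, P x -> Q x) ->
  {ae mu, forall x, P x} -> {ae mu, forall x, Q x}.
Proof. exact: (@filterS _ _ (ae_filter_ringOfSetsType mu)). Qed.

Lemma aeI (P Q : R -> Prop) : {ae mu, forall x, P x} ->
  {ae mu, forall x, Q x} -> {ae mu, forall x, P x /\ Q x}.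
Proof. exact: (@filterI _ _ (ae_filter_ringOfSetsType mu)). Qed.

Definition preserving (phi : R -> R) := measurable_fun [set: R] phi /\
  forall A, measurable A -> mu (phi @^-1` A) = mu A.

Lemma preserving_shift c : preserving (fun x => c + x).
Proof.
pose phi : measurableTypeR R -> measurableTypeR R := fun x => c + x.
have mphi : measurable_fun [set: measurableTypeR R] phi by exact: measurable_funD.
split=> // A mA.
pose phiM : {mfun measurableTypeR R >-> measurableTypeR R} :=
  HB.pack phi (isMeasurableFun.Build _ _ _ _ _ mphi).
apply/esym.
apply: (@lebesgue_measure_unique R (pushforward mu phiM)) mA => X [[a b] _ <-].
have pE : phiM @^-1` `](a, b).1, (a, b).2]%classic = `]a - c, b - c]%classic.
  by apply/seteqP; split=> x /=; rewrite !in_itv/= /phi => /andP[ax xb];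
    apply/andP; split; lra.
transitivity (mu `]a - c, b - c]%classic); last by rewrite -pE.
rewrite !lebesgue_measure_itv/= !lte_fin ltrD2r.
by case: ifPn => // _; rewrite -!EFinB; congr EFin; ring.
Qed.

Lemma preserving_reflect c : preserving (fun x => c - x).
Proof.
split; first exact: measurable_funB.
move=> A mA; have [mc cA] := preserving_shift c.
rewrite -(cA A mA) -[RHS]lebesgue_measureN//.
by rewrite -(setTI (_ @^-1` _)); exact: mc.
Qed.

Lemma ge0_integral_preserving phi (f : R -> \bar R) (D : set R) :
  preserving phi -> measurable D -> measurable_fun D f ->
  (forall x, D x -> 0 <= f x)%E ->
  (\int[mu]_(x in phi @^-1` D) f (phi x) = \int[mu]_(x in D) f x)%E.
Proof.
move=> [mphi muphi] mD mf f0.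
pose phi' : measurableTypeR R -> measurableTypeR R := phi.
have mphi' : measurable_fun [set: measurableTypeR R] phi' by exact: mphi.
pose phiM : {mfun measurableTypeR R >-> measurableTypeR R} :=
  HB.pack phi' (isMeasurableFun.Build _ _ _ _ _ mphi').
transitivity (\int[pushforward mu phiM]_(x in D) f x)%E; last first.
  by apply: eq_measure_integral => A mA _; exact: muphi.
rewrite ge0_integral_pushforward// => x; rewrite inE; exact: f0.
Qed.

Lemma integral_preserving phi (f : R -> \bar R) :
  preserving phi -> measurable_fun [set: R] f ->
  (\int[mu]_x f (phi x) = \int[mu]_x f x)%E.
Proof.
move=> pphi mf; rewrite integralE [RHS]integralE.
have e1 := @ge0_integral_preserving phi (f ^\+)%E setT pphi measurableT
  (measurable_funepos mf) (fun x _ => funepos_ge0 f x).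
have e2 := @ge0_integral_preserving phi (f ^\-)%E setT pphi measurableT
  (measurable_funeneg mf) (fun x _ => funeneg_ge0 f x).
have e0 : phi @^-1` setT = setT by [].
rewrite e0 in e1 e2; rewrite -[in RHS]e1 -[in RHS]e2.
by congr (_ - _)%E; apply: eq_integral => x _; rewrite ?funeposE ?funenegE.
Qed.

Lemma Rintegral_preserving phi (f : R -> R) :
  preserving phi -> measurable_fun [set: R] f ->
  Rintegral mu setT (fun x => f (phi x)) = Rintegral mu setT f.
Proof.
move=> pphi mf; congr fine.
by apply: (@integral_preserving phi (EFin \o f)) => //; exact/measurable_EFinP.
Qed.

Lemma integrable_preserving phi (f : R -> R) :
  preserving phi -> measurable_fun [set: R] f ->
  mu.-integrable setT (EFin \o f) -> mu.-integrable setT (fun x => (f (phi x))%:E).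
Proof.
move=> pphi mf /integrableP[_ foo]; apply/integrableP; split.
  by apply/measurable_EFinP; exact: (measurableT_comp mf pphi.1).
have := @integral_preserving phi (fun x => `|(f x)%:E|%E) pphi.
by move=> ->//; apply: measurableT_comp => //; exact/measurable_EFinP.
Qed.

Lemma ae_preserving phi (P : R -> Prop) : preserving phi ->
  {ae mu, forall x, P x} -> {ae mu, forall x, P (phi x)}.
Proof.
move=> [mphi muphi] [B [mB B0 PB]]; exists (phi @^-1` B); split.
- by rewrite -(setTI (_ @^-1` _)); exact: mphi.
- by rewrite muphi.
- by move=> x /= nP; apply: PB.
Qed.

Lemma ae_eq_Rintegral (D : set R) (f g : R -> R) : measurable D ->
  measurable_fun D f -> measurable_fun D g ->
  {ae mu, forall x, D x -> f x = g x} ->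
  Rintegral mu D f = Rintegral mu D g.
Proof.
move=> mD mf mg fg; congr fine; apply: ae_eq_integral => //.
- exact/measurable_EFinP.
- exact/measurable_EFinP.
- by apply: aeS fg => x fgx Dx; rewrite /= fgx.
Qed.

Lemma Rintegral_sum (I : Type) (r : seq I) (F : I -> R -> R) :
  (forall i, mu.-integrable setT (EFin \o F i)) ->
  Rintegral mu setT (fun x => \sum_(i <- r) F i x) =
  \sum_(i <- r) Rintegral mu setT (F i).
Proof.
move=> iF; elim: r => [|i r IHr].
  rewrite big_nil -[RHS](mul0r (fine (mu setT))) -(@Rintegral_cst _ _ _ mu setT)//.
  by apply: eq_Rintegral => x _; rewrite big_nil.
rewrite big_cons -IHr -RintegralD//.
  by apply: eq_Rintegral => x _; rewrite big_cons.
have := integrable_sum measurableT r (P := xpredT) (fun i _ => iF i).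
by apply: eq_integrable => // x _; rewrite /= sumEFin.
Qed.

Lemma integrable_Rsum (I : Type) (r : seq I) (F : I -> R -> R) :
  (forall i, mu.-integrable setT (EFin \o F i)) ->
  mu.-integrable setT (fun x => (\sum_(i <- r) F i x)%:E).
Proof.
move=> iF.
have := integrable_sum measurableT r (P := xpredT) (fun i _ => iF i).
by apply: eq_integrable => // x _; rewrite /= sumEFin.
Qed.

End lebesgue_invariance.

Section locally_integrable_functions.
Variable R : realType.
Local Notation mu := (@lebesgue_measure R).
Implicit Types (z f : R -> R) (a b K M q : R).

Definition locint z := measurable_fun [set: R] z /\
  forall a b, mu.-integrable `[a, b] (EFin \o z).

(** On a bounded interval [1 + |z| ^ q] is integrable, and it dominates [|z|] because [q >= 1]. *)
Lemma Lq_loc_locint q z : 1 <= q -> Lq_loc q z -> locint z.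
Proof.
move=> q1 [mz zq]; split=> // a b.
have mzab : measurable_fun `[a, b] z by exact: measurable_funS mz.
have mpow : measurable_fun `[a, b] (fun x => `|z x| `^ q).
  apply: (measurableT_comp (measurable_powR q)).
  exact: measurableT_comp.
have ig : mu.-integrable `[a, b] (fun x => (1 + `|z x| `^ q)%:E).
  have -> : (fun x => (1 + `|z x| `^ q)%:E) =
      ((fun=> 1%:E) \+ (fun x => (`|z x| `^ q)%:E))%E by [].
  apply: integrableD => //.
    apply: (@measurable_bounded_integrable _ _ _ _ (fun=> 1)) => //.
      by rewrite /= lebesgue_measure_itv/=; case: ifPn => // _; rewrite -EFinB ltry.
    by apply: bounded_cst.
  apply/integrableP; split; first exact/measurable_EFinP.
  under eq_integral do rewrite gee0_abs ?lee_fin ?powR_ge0//.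
  exact: zq.
apply: le_integrable ig => //.
- exact/measurable_EFinP.
- move=> x _; rewrite /= lee_fin [leRHS]ger0_norm ?addr_ge0 ?powR_ge0//.
  have [z1|z1] := leP 1 `|z x|.
    by apply: (le_trans (le1r_powR z1 q1)); rewrite lerDr.
  by apply: (le_trans (ltW z1)); rewrite lerDl powR_ge0.
Qed.

Lemma Lq_fun_loc q z : Lq_fun q z -> Lq_loc q z.
Proof.
move=> [mz zq]; split=> // a b; apply: le_lt_trans zq.
apply: ge0_subset_integral => //.
apply/measurable_EFinP/(measurableT_comp (measurable_powR q)).
exact: measurableT_comp.
Qed.

Lemma Lq_loc_shift q z c : Lq_loc q z -> Lq_loc q (fun t => z (c + t)).
Proof.
move=> [mz zq]; have pc := preserving_shift c.
split; first exact: (measurableT_comp mz pc.1).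
move=> a b; have := zq (c + a) (c + b).
have mpow : measurable_fun [set: R] (fun x => (`|z x| `^ q)%:E).
  apply/measurable_EFinP/(measurableT_comp (measurable_powR q)).
  exact: measurableT_comp.
rewrite -(ge0_integral_preserving pc)//; last first.
  by apply: measurable_funTS; exact: mpow.
congr (integral _ _ _ < _)%E; apply/seteqP.
by split=> x /=; rewrite !in_itv/= !lerD2l.
Qed.

(** Stated in the extended reals so that it serves twice: for the integrability of [z * f], and then
    for the constant in [rmeas_fdistr]. *)
Lemma integral_norm_le z f a K M : locint z ->
  {ae mu, forall t, t < a -> z t = 0} -> measurable_fun [set: R] f ->
  vanish_gt K f -> (forall t, a <= t -> `|f t| <= M) ->
  (\int[mu]_t `|z t * f t|%:E <= (Rintegral mu `[a, K] (fun t => `|z t|) * M)%:E)%E.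
Proof.
move=> [mz iz] za mf fK fM.
have mzf : measurable_fun [set: R] (fun t => `|z t * f t|%:E).
  by apply/measurable_EFinP/measurableT_comp => //; exact: measurable_funM.
have iz' : mu.-integrable `[a, K] (EFin \o (fun t => `|z t|)).
  by have := integrable_abse (iz a K); apply: eq_integrable.
have -> : (\int[mu]_t `|z t * f t|%:E = \int[mu]_(t in `[a, K]) `|z t * f t|%:E)%E.
  rewrite [RHS]integral_mkcond; apply: ae_eq_integral => //.
    apply/measurable_restrict => //; rewrite ?setTI//.
    exact: measurable_funS mzf.
  apply: aeS za => t zt _; rewrite patchE; case: ifPn => // nt.
  have [/zt ->|at_] := ltP t a; first by rewrite mul0r normr0.
  rewrite fK ?mulr0 ?normr0// ltNge; apply: contra nt => tK.
  by rewrite inE/= in_itv/= at_ tK.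
apply: (@le_trans _ _ (\int[mu]_(t in `[a, K]) (`|z t| * M)%:E)%E).
  apply: ge0_le_integral => //.
  - exact: measurable_funS mzf.
  - apply/measurable_EFinP/measurable_funM => //.
    by apply: measurableT_comp => //; exact: measurable_funS mz.
  - move=> t /=; rewrite in_itv/= => /andP[at_ _].
    by rewrite lee_fin normrM ler_wpM2l// fM.
rewrite -RintegralZr// /Rintegral fineK//.
apply: integrable_fin_num => //.
have iM mD := integrableZr mD M iz'.
by apply: eq_integrable (iM _).
Qed.

Lemma integrable_locint_mul z f a : locint z ->
  {ae mu, forall t, t < a -> z t = 0} -> measurable_fun [set: R] f ->
  (exists K, vanish_gt K f) -> (exists M, forall t, a <= t -> `|f t| <= M) ->
  mu.-integrable setT (EFin \o (fun t => z t * f t)).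
Proof.
move=> lz za mf [K fK] [M fM]; apply/integrableP; split.
  by apply/measurable_EFinP; apply: measurable_funM; [exact: lz.1|exact: mf].
by apply: (le_lt_trans (integral_norm_le lz za mf fK fM)); rewrite ltry.
Qed.

Lemma smooth_measurable f : smooth f -> measurable_fun [set: R] f.
Proof.
by move=> sf; apply: continuous_measurable_fun; exact: smooth_continuous.
Qed.

Lemma integrable_locint_rtest z f a : locint z ->
  {ae mu, forall t, t < a -> z t = 0} -> rtest f ->
  mu.-integrable setT (EFin \o (fun t => z t * f t)).
Proof.
move=> lz za rf; apply: (integrable_locint_mul lz za).
- exact: smooth_measurable rf.1.
- exact: rf.2.
- exact: rtest_bounded.
Qed.

Lemma rmeas_fdistr z a : locint z -> {ae mu, forall t, t < a -> z t = 0} ->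
  rmeas a (fdistr z).
Proof.
move=> lz za; split=> [c f g rf rg|K].
  have zf := integrable_locint_rtest lz za rf.
  have zg := integrable_locint_rtest lz za rg.
  rewrite /fdistr -RintegralZl// -RintegralD//.
    by apply: eq_Rintegral => x _; ring.
  have := integrableZl measurableT c zf.
  by apply: eq_integrable.
exists (Rintegral mu `[a, K] (fun t => `|z t|)) => f M rf fK fM.
have zf := integrable_locint_rtest lz za rf.
have zfM := integral_norm_le lz za (smooth_measurable rf.1) fK fM.
rewrite -lee_fin; apply: le_trans zfM.
rewrite EFin_normr_Rintegral//; apply: le_abse_integral => //.
by have /integrableP[] := zf.
Qed.

Lemma bounded_locint z M : measurable_fun [set: R] z -> (forall t, `|z t| <= M) ->
  locint z.
Proof.
move=> mz zM; split=> // a b; apply: measurable_bounded_integrable => //.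
- by rewrite /= lebesgue_measure_itv/=; case: ifPn => // _; rewrite -EFinB ltry.
- exact: measurable_funS mz.
- exists M; split; first exact: num_real.
  by move=> N MN t _; exact: le_trans (zM t) (ltW MN).
Qed.

Lemma fdistr_shift z c f : measurable_fun [set: R] z -> rtest f ->
  fdistr z (fun t => f (c + t)) = fdistr (fun t => z (- c + t)) f.
Proof.
move=> mz rf.
have := @Rintegral_preserving _ _ (fun t => z (- c + t) * f t) (preserving_shift c).
rewrite /fdistr => <-.
  by apply: eq_Rintegral => t _; rewrite addKr.
apply: measurable_funM; last exact: smooth_measurable rf.1.
exact: (measurableT_comp mz (preserving_shift (- c)).1).
Qed.

End locally_integrable_functions.

(** * Convolution of a bounded, compactly supported kernel with a function, by Fubini *)

Section convolution_of_functions.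
Variable R : realType.
Local Notation mu := (@lebesgue_measure R).
Variables (g x : R -> R) (L G a : R).
Hypotheses (mg : measurable_fun [set: R] g) (gG : forall s, `|g s| <= G).
Hypothesis g0 : forall s, ~~ (0 <= s <= L) -> g s = 0.
Hypotheses (lx : locint x) (xa : {ae mu, forall t, t < a -> x t = 0}).

Definition fconv (t : R) := Rintegral mu setT (fun s => g s * x (t - s)).

(** Reflection swaps the roles: [x] is integrated against the bounded function [g (t - .)], which
    vanishes to the right of [t]. Hence the claim holds for every [t], not just almost every one. *)
Lemma integrable_kernel_section t :
  mu.-integrable setT (EFin \o (fun s => g s * x (t - s))).
Proof.
have mgt : measurable_fun [set: R] (fun s => g (t - s)).
  exact: (measurableT_comp mg (preserving_reflect t).1).
have : mu.-integrable setT (EFin \o (fun s => x s * g (t - s))).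
  apply: (integrable_locint_mul lx xa) => //; last by exists G => s _.
  by exists t => s ts; apply: g0; rewrite subr_ge0 leNgt ts.
move/(integrable_preserving (preserving_reflect t)).
have mxg : measurable_fun [set: R] (fun s => x s * g (t - s)).
  exact: measurable_funM lx.1 mgt.
by move/(_ mxg); apply: eq_integrable => // s _; rewrite /= subKr mulrC.
Qed.

Lemma integrable_kernel : mu.-integrable setT (EFin \o g).
Proof.
have := (bounded_locint mg gG).2 0 L.
move/integrable_mkcond => /(_ (measurable_itv `[0, L])).
apply: eq_integrable => // s _; rewrite patchE; case: ifPn => //.
by rewrite notin_setE/= in_itv/= => /negP /g0 ->.
Qed.

(** After the shift by [s >= 0], [f (s + .)] obeys the same bounds as [f], so the estimate depends
    on [s] only through [|g s|]. *)
Lemma kernel_section_le K M f s : measurable_fun [set: R] f ->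
  vanish_gt K f -> (forall t, a <= t -> `|f t| <= M) ->
  (\int[mu]_t `|g s * x (t - s) * f t|%:E <=
   (`|g s| * (Rintegral mu `[a, K] (fun t => `|x t|) * M))%:E)%E.
Proof.
move=> mf fK fM.
have [sL|sL] := boolP (0 <= s <= L); last first.
  by rewrite g0// normr0 mul0r integral0_eq// => t _; rewrite !mul0r normr0.
have /andP[s0 _] := sL.
have mF : measurable_fun [set: R] (fun t => `|g s * x (t - s) * f t|%:E).
  apply/measurable_EFinP/measurableT_comp => //; apply: measurable_funM => //.
  apply: measurable_funM => //; apply: (measurableT_comp lx.1).
  exact: measurable_funB.
have mfs : measurable_fun [set: R] (fun t => f (s + t)).
  exact: (measurableT_comp mf (preserving_shift s).1).
rewrite -(integral_preserving (preserving_shift s) mF).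
rewrite (_ : (fun t => _) =
    fun t => (`|g s|%:E * `|x t * f (s + t)|%:E)%E); last first.
  by apply/funext => t; rewrite (addrC s t) addrK -mulrA normrM EFinM.
rewrite ge0_integralZl_EFin//.
  rewrite EFinM lee_wpmul2l//.
  apply: (integral_norm_le lx xa mfs) => t.
    by move=> Kt; apply: fK; rewrite (lt_le_trans Kt)// lerDr.
  by move=> at_; apply: fM; rewrite (le_trans at_)// lerDr.
apply/measurable_EFinP/measurableT_comp => //; apply: measurable_funM => //.
exact: lx.1.
Qed.

Lemma fubini_kernel f : rtest f ->
  (mu \x mu)%E.-integrable setT (fun p => (g p.2 * x (p.1 - p.2) * f p.1)%:E).
Proof.
move=> rf; have [sf [K fK]] := rf; have [M fM] := rtest_bounded a rf.
have mf := smooth_measurable sf.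
have mk : measurable_fun setT
    (fun p : R * R => (g p.2 * x (p.1 - p.2) * f p.1)%:E).
  apply/measurable_EFinP; apply: measurable_funM; last exact: measurableT_comp.
  apply: measurable_funM; first exact: measurableT_comp.
  apply: (measurableT_comp lx.1).
  exact: measurable_funB.
apply/integrable21ltyP => //.
pose C := Rintegral mu `[a, K] (fun t => `|x t|) * M.
have C0 : 0 <= C.
  rewrite mulr_ge0 ?(le_trans _ (fM a _))//.
  by apply: Rintegral_ge0 => t _.
have iC : mu.-integrable setT (fun s => (`|g s| * C)%:E).
  have := integrableZr measurableT C (integrable_abse integrable_kernel).
  by apply: eq_integrable.
apply: (@le_lt_trans _ _ (\int[mu]_s (`|g s| * C)%:E)%E); last first.
  by rewrite ltey_eq integrable_fin_num.
apply: ge0_le_integral => //.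
- by move=> s _; apply: integral_ge0.
- have mabs := measurableT_comp (@abse_measurable R setT) mk.
  exact: (@measurable_fun_fubini_tonelli_G _ _ (measurableTypeR R)
    (measurableTypeR R) R mu _ mabs (fun p => abse_ge0 _)).
- by have /integrableP[] := iC.
- by move=> s _; exact: kernel_section_le.
Qed.

(** Integrability is part of the conclusion: [fconv] is controlled only through its products with
    [f], and Fubini supplies it together with the identity. *)
Lemma rconv_fdistr f : rtest f ->
  mu.-integrable setT (EFin \o (fun t => fconv t * f t)) /\
  rconv (fdistr g) (fdistr x) f = fdistr fconv f.
Proof.
move=> rf; have iF := fubini_kernel rf.
have mf := smooth_measurable rf.1.
have G_fconv t : (\int[mu]_s (g s * x (t - s) * f t)%:E = (fconv t * f t)%:E)%E.
  have iz : mu.-integrable setT (EFin \o (fun s => g s * x (t - s) * f t)).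
    have := integrableZr measurableT (f t) (integrable_kernel_section t).
    by apply: eq_integrable.
  rewrite -[LHS]fineK; last exact: integrable_fin_num.
  congr EFin; rewrite -/(Rintegral mu setT _) RintegralZr//.
  exact: integrable_kernel_section.
split.
  have := integrable_fubini_F iF; apply: eq_integrable => // t _.
  exact: G_fconv.
rewrite /rconv /fdistr /Rintegral; congr fine.
under [RHS]eq_integral do rewrite -G_fconv.
rewrite (Fubini iF); apply: eq_integral => s _ /=.
have rs := rtest_shift s rf.
have ix := integrable_locint_rtest lx xa rs.
rewrite -RintegralZl//.
have ms : measurable_fun [set: R] (fun t => (g s * x (t - s) * f t)%:E).
  apply/measurable_EFinP/measurable_funM => //; apply: measurable_funM => //.
  apply: (measurableT_comp lx.1); exact: measurable_funB.
rewrite -(integral_preserving (preserving_shift s) ms) /Rintegral fineK.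
  by apply: eq_integral => t _; rewrite (addrC s t) addrK mulrA.
apply: integrable_fin_num => //.
have := integrableZl measurableT (g s) ix.
by apply: eq_integrable.
Qed.

End convolution_of_functions.

(** * Vanishing almost everywhere off the essential support *)

Section essential_support.
Variable R : realType.
Local Notation mu := (@lebesgue_measure R).

Lemma measurable_cV_neq0 m (u : R -> 'cV[R]_m) :
  (forall i, measurable_fun [set: R] (fun t => u t i 0)) ->
  measurable [set t | u t != 0].
Proof.
move=> mu_.
have -> : [set t | u t != 0] =
    \bigcup_(i in [set: 'I_m]) ((fun t => u t i 0) @^-1` [set~ 0]).
  apply/seteqP; split=> t /=.
  - move=> /matrix0Pn[i [j uij]]; exists i => //=.
    by apply/eqP; rewrite (ord1 j) in uij.
  - by move=> [i _ /= /eqP ui]; apply/matrix0Pn; exists i, 0.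
apply: fin_bigcup_measurable; first exact: finite_finset.
move=> i _; rewrite -[_ @^-1` _]setTI.
by apply: mu_ => //; exact: measurableC.
Qed.

(** A point off the essential support has a neighbourhood with rational endpoints on which [u]
    vanishes almost everywhere; the exceptional set is a countable union of such null sets. *)
Lemma ae_eq0_off_ess_supp m (u : R -> 'cV[R]_m) :
  (forall i, measurable_fun [set: R] (fun t => u t i 0)) ->
  {ae mu, forall t, ~ ess_supp u t -> u t = 0}.
Proof.
move=> mu_; have mu0 := measurable_cV_neq0 mu_.
pose Z (p : rat * rat) := `]ratr p.1, ratr p.2[%classic `&` [set t | u t != 0].
have mZ p : measurable (Z p) by exact: measurableI.
pose F (n : nat) := if unpickle n is Some p then
  (if mu (Z p) == 0%E then Z p else set0) else set0.
have FZ p : mu (Z p) = 0%E -> F (pickle p) = Z p.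
  by move=> Z0; rewrite /F pickleK Z0 eqxx.
have nF : mu.-negligible (\bigcup_n F n).
  apply: negligible_bigcup => n; rewrite /F; case: unpickle => [p|]; last first.
    exact: negligible_set0.
  case: ifPn => [/eqP Z0|_]; last exact: negligible_set0.
  by exists (Z p); split; [exact: mZ|exact: Z0|exact: subset_refl].
apply: negligibleS nF => t /= /not_implyP[nt ut].
have [e /not_implyP[e0 /negP ne]] :
    exists e : R, ~ (0 < e -> (0 < mu (nz_near u t e))%E).
  exact/existsNP.
have te : t - e < t by rewrite ltrBlDr ltrDl.
have et : t < t + e by rewrite ltrDl.
have [q1] := rat_in_itvoo te; rewrite in_itv/= => /andP[eq1 q1t].
have [q2] := rat_in_itvoo et; rewrite in_itv/= => /andP[tq2 q2e].
have mnz : measurable (nz_near u t e).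
  have -> : nz_near u t e = `]t - e, t + e[%classic `&` [set t | u t != 0].
    by apply/seteqP; split=> s; rewrite /nz_near /= in_itv/=.
  exact: measurableI.
have Z0 : mu (Z (q1, q2)) = 0%E.
  apply/eqP; rewrite eq_le measure_ge0 andbT.
  apply: (@le_trans _ _ (mu (nz_near u t e))); last by rewrite leNgt.
  apply: le_measure; rewrite ?inE//; first exact: mZ.
  move=> s [/=]; rewrite in_itv/= => /andP[q1s sq2] us; split=> //.
  by rewrite (lt_trans eq1)//= (lt_trans sq2).
exists (pickle (q1, q2)); first exact: I.
rewrite FZ//; split; last exact/eqP.
by rewrite /= in_itv/= q1t.
Qed.

End essential_support.

Section bounded_kernels.
Variable R : realType.
Local Notation mu := (@lebesgue_measure R).

Lemma fdistr_wbound (g f : R -> R) (G lam M : R) : 0 < lam ->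
  measurable_fun [set: R] g -> (forall s, `|g s| <= G) ->
  (forall s, s < 0 -> g s = 0) -> rtest f -> wbound lam M f ->
  `|fdistr g f| <= G / lam * M.
Proof.
move=> lam0 mg gG g0 rf fM.
have M0 := wbound_ge0 fM; have G0 : 0 <= G by exact: le_trans (gG 0).
have GM0 : 0 <= G / lam * M by rewrite !mulr_ge0// invr_ge0 ltW.
have lg := bounded_locint mg gG.
have ig : mu.-integrable setT (EFin \o (fun t => g t * f t)).
  by apply: (integrable_locint_rtest lg (a := 0)) => //; exact: aeW.
rewrite -lee_fin EFin_normr_Rintegral//.
apply: (le_trans (le_abse_integral _ _ _)) => //; first by have /integrableP[] := ig.
(* The exponential density of rate [lam] has mass 1, so the bound is the integral of
   [G * M * e^(- lam t)] over [t >= 0]. *)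
have -> : (G / lam * M)%:E =
    (\int[mu]_t ((G / lam * M)%:E * (exponential_pdf lam t)%:E))%E.
  rewrite ge0_integralZl_EFin//.
  - by rewrite integral_exponential_pdf// mule1.
  - by move=> t _; rewrite lee_fin exponential_pdf_ge0// ltW.
  - apply/measurable_EFinP; exact: measurable_exponential_pdf.
apply: ge0_le_integral => //.
- by have /integrableP[mgf _] := ig; exact: measurableT_comp.
- apply: measurable_funeM; apply/measurable_EFinP.
  exact: measurable_exponential_pdf.
- move=> t _; rewrite /= -EFinM lee_fin.
  have [t0|t0] := ltP t 0.
    by rewrite g0// mul0r normr0 mulr_ge0// exponential_pdf_ge0// ltW.
  rewrite /exponential_pdf patchE ifT; last by rewrite inE/= in_itv/= t0.
  have -> : G / lam * M * (lam * expR (- lam * t)) = G * (M * expR (- (lam * t))).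
    by rewrite mulNr; field; rewrite gt_eqF.
  by rewrite normrM ler_pM// fM.
Qed.

(** Extension by 0 and truncation turn an essentially bounded kernel on [[0, L]] into one bounded
    everywhere on the line. The level is [|M|], as no sign of [M] is assumed. *)
Lemma bounded_representative (g : R -> R) (L M : R) :
  measurable_fun `[0, L] g ->
  exists g1 : R -> R, [/\ measurable_fun [set: R] g1,
    forall s, `|g1 s| <= `|M|, forall s, ~~ (0 <= s <= L) -> g1 s = 0 &
    forall s, 0 <= s <= L -> `|g s| <= M -> g1 s = g s].
Proof.
move=> mg; pose h := g \_ `[0, L].
have mh : measurable_fun [set: R] h.
  by apply/(measurable_restrictT g (measurable_itv `[0, L])).
exists (fun s => Num.max (- `|M|) (Num.min `|M| (h s))); split.
- by apply: measurable_maxr => //; exact: measurable_minr.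
- move=> s; rewrite ler_norml le_max lexx/= ge_max ge_min lexx/= andbT.
  by rewrite (@le_trans _ _ 0)// oppr_le0.
- move=> s nsL; rewrite /h patchE ifF; last first.
    by apply: negbTE; rewrite notin_setE/= in_itv/=; exact/negP.
  by rewrite (min_idPr (normr_ge0 M)) (max_idPr _)// oppr_le0.
- move=> s sL gM; rewrite /h patchE ifT; last by rewrite inE/= in_itv/=.
  have {}gM := le_trans gM (ler_norm M); move: gM; rewrite ler_norml => /andP[g1 g2].
  by rewrite (min_idPr g2) (max_idPr g1).
Qed.

End bounded_kernels.

(** * The delay system *)

Section shifted_inverse.
Variables (R : realType).
Implicit Types (f : R -> R).

(** Entrywise convolution with the Dirac mass at [c]. *)
Definition mshift (c : R) n p (S : dmx R n p) : dmx R n p :=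
  fun i j f => S i j (fun x => f (c + x)).

Lemma mrmeas_shift (a c : R) n p (S : dmx R n p) :
  mrmeas a S -> mrmeas (a + c) (mshift c S).
Proof. by move=> mS i j; exact: rmeas_shift. Qed.

Lemma mconv_shift (b c : R) n p r (S : dmx R n p) (T : dmx R p r) i j f :
  b + c = 0 -> mconv (mshift b S) (mshift c T) i j f = mconv S T i j f.
Proof.
move=> bc; apply: eq_bigr => k _; rewrite /rconv /mshift /translates.
congr (S i k); apply/funext => x; congr (T k j); apply/funext => y.
by congr f; rewrite addrACA bc add0r.
Qed.

Definition idsub n (k : dmx R n n) : dmx R n n :=
  fun i j f => mdelta i j f - k i j f.

Lemma mrmeas_idsub n (k : dmx R n n) : mrmeas 0 k -> mrmeas 0 (idsub k).
Proof.
move=> mk i j; have := rmeas_lin (-1) (mk i j) (@mrmeas_delta R n i j).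
by congr rmeas; apply/funext => f; rewrite mulN1r addrC.
Qed.

Lemma mconv_idsubl n p (k : dmx R n n) (T : dmx R n p) i j f :
  mconv (idsub k) T i j f = T i j f - mconv k T i j f.
Proof. by rewrite -[in RHS](mconv_deltal T) -sumrB. Qed.

Lemma mconv_idsubr (a : R) n p (k : dmx R p p) (T : dmx R n p) i j f :
  mrmeas a T -> mrmeas 0 k -> rtest f ->
  mconv T (idsub k) i j f = T i j f - mconv T k i j f.
Proof.
move=> mT mk rf; rewrite -[in RHS](mconv_deltar i j mT rf) -sumrB.
apply: eq_bigr => l _; rewrite /rconv -(rmeasB (mT i l))//.
- exact: (rtest_translates (@mrmeas_delta R p l j)).
- exact: (rtest_translates (mk l j)).
Qed.

End shifted_inverse.

Section delay_system.
Variables (R : realType) (d m N : nat) (Lam : nat -> R).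
Variables (A : nat -> 'M[R]_(d, d)) (B : 'M[R]_(d, m)).
Variables (h : 'I_d -> 'I_d -> R -> R) (G : R).
Local Notation mu := (@lebesgue_measure R).
Local Notation L := (Lam N).

Hypothesis Lam1 : 0 < Lam 1%N.
Hypothesis delays : forall l : 'I_N, Lam 1%N <= Lam l.+1 <= L.
Hypothesis L0 : 0 < L.
Hypothesis mh : forall i j, measurable_fun [set: R] (h i j).
Hypothesis hG : forall i j s, `|h i j s| <= G.
Hypothesis h0 : forall i j s, ~~ (0 <= s <= L) -> h i j s = 0.

Definition delay_kernel : dmx R d d := fun i j f =>
  \sum_(l < N) A l.+1 i j * f (Lam l.+1) + fdistr (h i j) f.

Lemma delay_ge0 (l : 'I_N) : 0 <= Lam l.+1.
Proof. by have /andP[Ll _] := delays l; exact: le_trans (ltW Lam1) Ll. Qed.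

Lemma h_lt0 i j s : s < 0 -> h i j s = 0.
Proof. by move=> s0; apply: h0; rewrite leNgt s0. Qed.

Lemma mrmeas_delay_kernel : mrmeas 0 delay_kernel.
Proof.
move=> i j; apply: rmeas_add.
  by apply: rmeas_bigsum => l; apply/rmeas_scale/rmeas_dirac/delay_ge0.
apply: rmeas_fdistr; first exact: bounded_locint (mh i j) (hG i j).
by apply: aeW => s; exact: h_lt0.
Qed.

(* [delay_mass / lam] dominates the weighted norm of the kernel because
   [e^(- lam Lam_l) <= 1 / (lam Lam_1)]. *)
Definition delay_mass : R :=
  (\sum_i \sum_j \sum_(l < N) `|A l.+1 i j|) / Lam 1%N + `|G|.

Lemma delay_mass_ge0 : 0 <= delay_mass.
Proof.
rewrite addr_ge0// divr_ge0 ?(ltW Lam1)//.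
by do 3 (apply: sumr_ge0 => ? _).
Qed.

Lemma delay_kernel_wbound lam i j f M : 0 < lam -> rtest f -> wbound lam M f ->
  `|delay_kernel i j f| <= delay_mass / lam * M.
Proof.
move=> lam0 rf fM; have M0 := wbound_ge0 fM.
rewrite (le_trans (ler_normD _ _))// !mulrDl lerD//; last first.
  apply: (fdistr_wbound lam0 (mh i j) _ _ rf fM) => s; last exact: h_lt0.
  by rewrite (le_trans (hG i j s))// ler_norm.
(* The sum for one entry is at most the sum over all entries, so one constant serves every [i] and
   [j]. *)
apply: (@le_trans _ _ ((\sum_(l < N) `|A l.+1 i j|) / Lam 1%N / lam * M));
  last first.
  rewrite !ler_wpM2r ?invr_ge0 ?(ltW lam0) ?(ltW Lam1)//.
  rewrite (bigD1 i)//= (bigD1 j)//= -addrA lerDl addr_ge0//.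
    by do 2 (apply: sumr_ge0 => ? _).
  by do 3 (apply: sumr_ge0 => ? _).
rewrite !mulr_suml (le_trans (ler_norm_sum _ _ _))//; apply: ler_sum => l _.
rewrite normrM -!mulrA ler_wpM2l//; apply: (le_trans (fM _ (delay_ge0 l))).
rewrite mulrC mulrA ler_wpM2r// -invfM expRN lef_pV2 ?posrE ?expR_gt0 ?mulr_gt0//.
have /andP[Ll _] := delays l.
rewrite mulrC; apply: (@le_trans _ _ (lam * Lam l.+1)); first by rewrite ler_pM2l.
by apply: le_trans (expR_ge1Dx _); rewrite lerDr.
Qed.

(** The factor [2 * d] yields the contraction 1/2 required by the Neumann series; the [+ 1] keeps
    the rate positive when the mass is 0. *)
Definition delay_rate : R := 2 * d%:R * delay_mass + 1.

Lemma delay_rate_gt0 : 0 < delay_rate.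
Proof. by rewrite ltr_pwDr// !mulr_ge0// delay_mass_ge0. Qed.

Lemma delay_rate_half : d%:R * (delay_mass / delay_rate) <= 2^-1.
Proof.
rewrite mulrA ler_pdivrMr ?delay_rate_gt0// /delay_rate; have := delay_mass_ge0.
by lra.
Qed.

Definition delay_resolvent : dmx R d d := neumann delay_kernel.

Lemma mrmeas_delay_resolvent : mrmeas 0 delay_resolvent.
Proof.
apply: (mrmeas_neumann (lam := delay_rate) (c := delay_mass / delay_rate)).
- exact/ltW/delay_rate_gt0.
- exact: delay_rate_half.
- exact: mrmeas_delay_kernel.
- by move=> i j f M; apply: delay_kernel_wbound; exact: delay_rate_gt0.
Qed.

Lemma delay_resolventl i j f : rtest f ->
  mconv (idsub delay_kernel) delay_resolvent i j f = mdelta i j f.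
Proof.
move=> rf; rewrite mconv_idsubl; apply/eqP; rewrite subr_eq; apply/eqP.
apply: (neumannl (lam := delay_rate) (c := delay_mass / delay_rate)) => //.
- exact/ltW/delay_rate_gt0.
- exact: delay_rate_half.
- exact: mrmeas_delay_kernel.
- by move=> *; apply: delay_kernel_wbound => //; exact: delay_rate_gt0.
Qed.

Lemma delay_resolventr i j f : rtest f ->
  mconv delay_resolvent (idsub delay_kernel) i j f = mdelta i j f.
Proof.
move=> rf.
rewrite (mconv_idsubr _ _ mrmeas_delay_resolvent mrmeas_delay_kernel rf).
apply/eqP; rewrite subr_eq; apply/eqP.
apply: (neumannr (lam := delay_rate) (c := delay_mass / delay_rate)) => //.
- exact/ltW/delay_rate_gt0.
- exact: delay_rate_half.
- exact: mrmeas_delay_kernel.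
- by move=> *; apply: delay_kernel_wbound => //; exact: delay_rate_gt0.
Qed.

Definition delay_Q : dmx R d d := mshift (- L) (idsub delay_kernel).
Definition delay_Qinv : dmx R d d := mshift L delay_resolvent.
Definition delay_P : dmx R d m := fun i j f => B i j * f 0.

Lemma mrmeas_delay_Q : mrmeas (0 + - L) delay_Q.
Proof. exact/mrmeas_shift/mrmeas_idsub/mrmeas_delay_kernel. Qed.

Lemma mrmeas_delay_Qinv : mrmeas (0 + L) delay_Qinv.
Proof. exact/mrmeas_shift/mrmeas_delay_resolvent. Qed.

Lemma mrmeas_delay_P : mrmeas 0 delay_P.
Proof. by move=> i j; apply/rmeas_scale/rmeas_dirac. Qed.

Lemma delay_QinvQ i j f : rtest f -> mconv delay_Qinv delay_Q i j f = mdelta i j f.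
Proof. by move=> rf; rewrite mconv_shift ?subrr// delay_resolventr. Qed.

Lemma delay_QQinv i j f : rtest f -> mconv delay_Q delay_Qinv i j f = mdelta i j f.
Proof. by move=> rf; rewrite mconv_shift ?addNr// delay_resolventl. Qed.

Lemma delay_Q_in_Eminus i j : in_Eminus (delay_Q i j).
Proof.
split; first exact: rmeas_is_distr (mrmeas_delay_Q i j).
exists (- L); split; first by rewrite oppr_le0 ltW.
move=> phi tphi [e [e0 phi0]].
(* Each term of [Q] evaluates [phi] only at such points: [s = 0], [s] a delay, or [s] where [h] may
   be nonzero. *)
have phiL s : 0 <= s <= L -> phi (- L + s) = 0.
  by move=> /andP[s0 sL]; apply: phi0; apply/andP; split; lra.
rewrite /delay_Q /mshift /idsub /mdelta phiL ?lexx ?(ltW L0)// mulr0.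
rewrite /delay_kernel big1 => [|l _]; last first.
  by rewrite phiL ?mulr0// delay_ge0; have /andP[] := delays l.
rewrite /fdistr (_ : (fun s => _) = fun=> 0); last first.
  apply/funext => s; have [/phiL ->|/h0 ->] := boolP (0 <= s <= L).
    by rewrite mulr0.
  by rewrite mul0r.
by rewrite Rintegral_cst// mul0r addr0 subr0.
Qed.

Lemma delay_P_in_Eminus i j : in_Eminus (delay_P i j).
Proof.
split; first exact: rmeas_is_distr (mrmeas_delay_P i j).
exists 0; split=> // phi tphi [e [e0 phi0]].
by rewrite /delay_P phi0 ?mulr0//; apply/andP; split; lra.
Qed.

End delay_system.

(** * From the state equation to its weak form *)

Section delay_equation.
Variables (R : realType) (d m N : nat) (Lam : nat -> R).
Variables (A : nat -> 'M[R]_(d, d)) (B : 'M[R]_(d, m)).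
Variables (h : 'I_d -> 'I_d -> R -> R) (G a : R).
Variables (u : R -> 'cV[R]_m) (x : R -> 'cV[R]_d).
Local Notation mu := (@lebesgue_measure R).
Local Notation L := (Lam N).

Hypothesis mh : forall i j, measurable_fun [set: R] (h i j).
Hypothesis hG : forall i j s, `|h i j s| <= G.
Hypothesis h0 : forall i j s, ~~ (0 <= s <= L) -> h i j s = 0.
Hypothesis lu : forall k, locint (fun t => u t k 0).
Hypothesis ua : {ae mu, forall t, t < a -> u t = 0}.
Hypothesis lx : forall k, locint (fun t => x t k 0).
Hypothesis xa : {ae mu, forall t, t < a -> x t = 0}.

Let xka k : {ae mu, forall t, t < a -> x t k 0 = 0}.
Proof. by apply: aeS xa => t xt ta; rewrite xt// mxE. Qed.

Let uka k : {ae mu, forall t, t < a -> u t k 0 = 0}.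
Proof. by apply: aeS ua => t ut ta; rewrite ut// mxE. Qed.

(** The equation is multiplied by [f] and integrated. Each product is integrable on the whole line,
    since [x] and [u] vanish to the left of [a] and [f] far to the right; for the distributed term
    this is [rconv_fdistr]. *)
Lemma delay_weak_equation i f : rtest f ->
  {ae mu, forall t, x t i 0 =
    \sum_k (\sum_(l < N) A l.+1 i k * x (- Lam l.+1 + t) k 0
            + fconv (h i k) (fun s => x s k 0) t)
    + \sum_k B i k * u t k 0} ->
  fdistr (fun t => x t i 0) f =
    \sum_k rconv (delay_kernel N Lam A h i k) (fdistr (fun t => x t k 0)) f
    + \sum_k B i k * fdistr (fun t => u t k 0) f.
Proof.
move=> rf eqx.
pose T1 k (l : 'I_N) t := A l.+1 i k * (x (- Lam l.+1 + t) k 0 * f t).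
pose T2 k t := fconv (h i k) (fun s => x s k 0) t * f t.
pose T3 k t := B i k * (u t k 0 * f t).
have ishift k (l : 'I_N) :
    mu.-integrable setT (EFin \o (fun t => x (- Lam l.+1 + t) k 0 * f t)).
  have rl := rtest_shift (Lam l.+1) rf.
  have il := integrable_locint_rtest (lx k) (xka k) rl.
  have mxf : measurable_fun [set: R] (fun t => x t k 0 * f (Lam l.+1 + t)).
    apply: measurable_funM; first exact: (lx k).1.
    exact: smooth_measurable rl.1.
  have := integrable_preserving (preserving_shift (- Lam l.+1)) mxf il.
  by apply: eq_integrable => // t _; rewrite /= addNKr.
have i1 k l : mu.-integrable setT (EFin \o T1 k l).
  have := integrableZl measurableT (A l.+1 i k) (ishift k l).
  by apply: eq_integrable.
have c2 k := rconv_fdistr (mh i k) (hG i k) (@h0 i k) (lx k) (xka k) rf.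
have i2 k : mu.-integrable setT (EFin \o T2 k) by exact: (c2 k).1.
have iu k := integrable_locint_rtest (lu k) (uka k) rf.
have i3 k : mu.-integrable setT (EFin \o T3 k).
  by have := integrableZl measurableT (B i k) (iu k); apply: eq_integrable.
have i12 k : mu.-integrable setT (EFin \o (fun t => \sum_l T1 k l t + T2 k t)).
  have := integrableD measurableT (integrable_Rsum (index_enum _) (i1 k)) (i2 k).
  by apply: eq_integrable.
have is12 := integrable_Rsum (index_enum _) i12.
have is3 := integrable_Rsum (index_enum _) i3.
have rk k : rconv (delay_kernel N Lam A h i k) (fdistr (fun t => x t k 0)) f =
    Rintegral mu setT (fun t => \sum_l T1 k l t + T2 k t).
  rewrite RintegralD//; last exact: integrable_Rsum.
  rewrite Rintegral_sum// /rconv /delay_kernel; congr (_ + _); last exact: (c2 k).2.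
  apply: eq_bigr => l _; rewrite /T1 RintegralZl//; congr (_ * _).
  exact: fdistr_shift (lx k).1 rf.
rewrite (eq_bigr _ (fun k _ => rk k)) -Rintegral_sum//.
have -> : \sum_k B i k * fdistr (fun t => u t k 0) f =
    Rintegral mu setT (fun t => \sum_k T3 k t).
  by rewrite Rintegral_sum//; apply: eq_bigr => k _; rewrite RintegralZl.
rewrite -RintegralD//; apply: ae_eq_Rintegral => //.
- apply: measurable_funM; first exact: (lx i).1.
  exact: smooth_measurable rf.1.
- have /integrableP[/measurable_EFinP m12 _] := is12.
  have /integrableP[/measurable_EFinP m3 _] := is3.
  exact: measurable_funD m12 m3.
- apply: aeS eqx => t -> _; rewrite mulrDl !mulr_suml; congr (_ + _).
    apply: eq_bigr => k _; rewrite mulrDl mulr_suml; congr (_ + _).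
    by apply: eq_bigr => l _; rewrite /T1 mulrA.
  by apply: eq_bigr => k _; rewrite /T3 mulrA.
Qed.

End delay_equation.

Section state_equation.
Variables (R : realType) (d m N : nat) (Lam : nat -> R).
Variables (A : nat -> 'M[R]_(d, d)) (B : 'M[R]_(d, m)).
Variables (g : R -> 'M[R]_(d, d)) (h : 'I_d -> 'I_d -> R -> R).
Variables (u : R -> 'cV[R]_m) (x : R -> 'cV[R]_d).
Local Notation mu := (@lebesgue_measure R).
Local Notation L := (Lam N).

Hypothesis delays : forall l : 'I_N, 0 <= Lam l.+1.
Hypothesis mg : forall i j, measurable_fun `[0, L] (fun s => g s i j).
Hypothesis mh : forall i j, measurable_fun [set: R] (h i j).
Hypothesis h0 : forall i j s, ~~ (0 <= s <= L) -> h i j s = 0.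
Hypothesis hg : forall i j, {ae mu, forall s, 0 <= s <= L -> h i j s = g s i j}.
Hypothesis mu_u : forall k, measurable_fun [set: R] (fun t => u t k 0).
Hypothesis mx : forall k, measurable_fun [set: R] (fun t => x t k 0).
Hypothesis x_eq : {ae mu, forall t, after_supp u t ->
  x t = \sum_(1 <= j < N.+1) A j *m x (t - Lam j)
    + \col_i (\sum_k Rintegral mu `[0, L] (fun s => g s i k * x (t - s) k 0))
    + B *m u t}.
Hypothesis x_before : {ae mu, forall t, ~ after_supp u t -> x t = 0}.

Lemma after_suppW s t : s <= t -> after_supp u s -> after_supp u t.
Proof. by move=> st [r [ru rs]]; exists r; split=> //; exact: le_trans st. Qed.

Lemma fconv_itv i k t : fconv (h i k) (fun s => x s k 0) t =
  Rintegral mu `[0, L] (fun s => g s i k * x (t - s) k 0).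
Proof.
have mxt : measurable_fun [set: R] (fun s => x (t - s) k 0).
  exact: (measurableT_comp (mx k) (preserving_reflect t).1).
rewrite /fconv [RHS](@ae_eq_Rintegral _ _ _ (fun s => h i k s * x (t - s) k 0))//.
- rewrite [RHS]Rintegral_mkcond; apply: eq_Rintegral => s _.
  rewrite patchE; case: ifPn => //; rewrite notin_setE/= in_itv/= => /negP ns.
  by rewrite h0// mul0r.
- apply: measurable_funM => //; exact: measurable_funTS.
- by apply: measurable_funTS; exact: measurable_funM.
- by apply: aeS (hg i k) => s hs; rewrite /= in_itv/= => /hs ->.
Qed.

Lemma fconv_before i k t : ~ after_supp u t ->
  fconv (h i k) (fun s => x s k 0) t = 0.
Proof.
move=> nt; rewrite /fconv (@ae_eq_Rintegral _ _ _ (fun=> 0))//.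
- by rewrite Rintegral_cst// mul0r.
- apply: measurable_funM => //.
  exact: (measurableT_comp (mx k) (preserving_reflect t).1).
- apply: aeS (ae_preserving (preserving_reflect t) x_before) => s xs _.
  have [/andP[s0 _]|/h0 ->] := boolP (0 <= s <= L); last by rewrite mul0r.
  rewrite xs ?mxE ?mulr0// => ts; apply/nt/(after_suppW _ ts).
  by rewrite gerBl.
Qed.

(** Before the support of [u] both sides vanish: [u] and [x] are 0 there, and delays only look
    further back. The equation thus extends to almost every real [t] and can be tested on the whole
    line. *)
Lemma state_equation : {ae mu, forall t i, x t i 0 =
  \sum_k (\sum_(l < N) A l.+1 i k * x (- Lam l.+1 + t) k 0
          + fconv (h i k) (fun s => x s k 0) t)
  + \sum_k B i k * u t k 0}.
Proof.
(* A single null set for all delays, as a countable union of translates of the exceptional set of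
   [x_before]. *)
have x_delayed : {ae mu, forall t (l : nat),
    ~ after_supp u (- Lam l.+1 + t) -> x (- Lam l.+1 + t) = 0}.
  apply: ae_foralln => l.
  exact: (ae_preserving (preserving_shift (- Lam l.+1)) x_before).
have u_before := ae_eq0_off_ess_supp mu_u.
apply: aeS (aeI (aeI x_eq x_before) (aeI x_delayed u_before)).
move=> t [[xt nxt] [dt ut]] i.
have [after|before] := pselect (after_supp u t).
- rewrite (xt after) big_add1/= big_mkord !mxE summxE; congr (_ + _).
  rewrite big_split/=; congr (_ + _).
    rewrite exchange_big/=; apply: eq_bigr => l _; rewrite mxE.
    by apply: eq_bigr => k _; rewrite (addrC t).
  by apply: eq_bigr => k _; rewrite fconv_itv.
- rewrite nxt// mxE ut; last by move=> ts; apply: before; exists t.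
  rewrite [X in _ + X]big1 ?addr0 => [|k _]; last by rewrite mxE mulr0.
  rewrite big1// => k _; rewrite fconv_before// addr0 big1// => l _.
  rewrite dt ?mxE ?mulr0// => tl; apply/before/(after_suppW _ tl).
  by rewrite gerDr oppr_le0.
Qed.

End state_equation.

Lemma increasing_delays (R : realType) (N : nat) (Lam : nat -> R) :
  (forall j, (1 <= j < N)%N -> Lam j < Lam j.+1) ->
  forall l : 'I_N, Lam 1%N <= Lam l.+1 <= Lam N.
Proof.
move=> inc.
have mono i k : (0 < i)%N -> (i + k <= N)%N -> Lam i <= Lam (i + k)%N.
  move=> i0; elim: k => [|k IHk] ikN; first by rewrite addn0.
  rewrite addnS in ikN *; apply: (le_trans (IHk (ltnW ikN))); apply/ltW/inc.
  by rewrite ikN addn_gt0 i0.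
move=> l; apply/andP; split; first by rewrite -add1n mono// add1n.
by rewrite -{2}(subnKC (ltn_ord l)) mono// subnKC.
Qed.

Theorem theorem5 (R : realType) (d m N : nat) (Lam : nat -> R)
    (A : nat -> 'M[R]_(d, d)) (B : 'M[R]_(d, m)) (g : R -> 'M[R]_(d, d)) (q : R) :
  (0 < d)%N -> (0 < m)%N -> (0 < N)%N ->
  0 < Lam 1%N ->
  (forall j, (1 <= j < N)%N -> Lam j < Lam j.+1) ->
  (forall i j, measurable_fun `[0, Lam N] (fun s => g s i j)) ->
  (exists M : R, {ae (@lebesgue_measure R), forall s, s \in `[0, Lam N] ->
       forall i j, `|g s i j| <= M}) ->
  1 <= q ->
  @pseudo_rational0 R d m q (@DI_io R d m N q Lam A B g).
Proof.
move=> _ _ N0 Lam1 Lam_inc mg [M gM] q1.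
have delays := increasing_delays Lam_inc.
have L0 : 0 < Lam N.
  have /andP[L1 LN] := delays (Ordinal N0).
  exact: lt_le_trans Lam1 (le_trans L1 LN).
have [h hP] := choice (fun ij : 'I_d * 'I_d =>
  bounded_representative M (mg ij.1 ij.2)).
pose k i j := h (i, j).
have mk i j : measurable_fun [set: R] (k i j) by have [] := hP (i, j).
have kM i j s : `|k i j s| <= `|M| by have [_ + _ _] := hP (i, j); apply.
have k0 i j s : ~~ (0 <= s <= Lam N) -> k i j s = 0.
  by have [_ _ + _] := hP (i, j); apply.
have kg i j : {ae (@lebesgue_measure R),
    forall s, 0 <= s <= Lam N -> k i j s = g s i j}.
  apply: aeS gM => s gs s0; have [_ _ _ +] := hP (i, j); apply=> //.
  by apply: gs; rewrite in_itv.
have mQ := mrmeas_delay_Q A Lam1 delays mk kM k0.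
have mQinv := mrmeas_delay_Qinv A Lam1 delays mk kM k0.
have mP := mrmeas_delay_P B.
have QinvQ := delay_QinvQ A Lam1 delays mk kM k0.
have QQinv := delay_QQinv A Lam1 delays mk kM k0.
have deltaE i j phi : @dmx_deltaI R d i j phi = mdelta i j phi.
  by rewrite /dmx_deltaI /mdelta; case: (i == j); rewrite ?mul1r ?mul0r.
exists (delay_Q N Lam A k), (delay_P B), (delay_Qinv N Lam A k).
split; first by move=> i j; exact: (delay_Q_in_Eminus A Lam1 delays L0 mk kM k0).
split; first by move=> i j; exact: delay_P_in_Eminus.
split; first by move=> i j; exact: rmeas_in_Dplus (mQinv i j).
split.
  move=> i j phi tphi; rewrite (dmx_conv_mconv mQinv mQ)//.
  by rewrite deltaE QinvQ//; exact: test_fun_rtest.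
split.
  move=> i j phi tphi; rewrite (dmx_conv_mconv mQ mQinv)//.
  by rewrite deltaE QQinv//; exact: test_fun_rtest.
split; first exact: dmx_det_order_zero mQinv.
move=> u y [uq [a [a0 ua]]] [x [xq [x_eq [x_before yx]]]].
have lu i : locint (fun t => u t i 0) by exact: Lq_loc_locint q1 (Lq_fun_loc (uq i)).
have lx i : locint (fun t => x t i 0) by exact: Lq_loc_locint q1 (xq i).
have u_lt : {ae (@lebesgue_measure R), forall t, t < a -> u t = 0}.
  apply: aeS (ae_eq0_off_ess_supp (fun i => (lu i).1)) => t ut ta; apply: ut => st.
  by have := ua _ st; rewrite /= in_itv/= leNgt ta.
have x_lt : {ae (@lebesgue_measure R), forall t, t < a -> x t = 0}.
  apply: aeS x_before => t xt ta; apply: xt => -[s [us st]].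
  by have := ua _ us; rewrite /= in_itv/= leNgt (le_lt_trans st ta).
have x_state := state_equation (delay_ge0 Lam1 delays) mg mk k0 kg
  (fun i => (lu i).1) (fun i => (lx i).1) x_eq x_before.
pose U : dmx R m 1 := fun i _ => fdistr (fun t => u t i 0).
pose X : dmx R d 1 := fun i _ => fdistr (fun t => x t i 0).
pose Z := mshift (Lam N) X.
have mU : mrmeas a U.
  move=> i j; apply: rmeas_fdistr => //.
  by apply: aeS u_lt => t ut ta; rewrite ut// mxE.
have mX : mrmeas a X.
  move=> i j; apply: rmeas_fdistr => //.
  by apply: aeS x_lt => t xt ta; rewrite xt// mxE.
have mZ : mrmeas (a + Lam N) Z by exact: mrmeas_shift.
(* The opposite shifts in [Q] and [Z] cancel, leaving the weak form of
   [(delta_0 I - K) * x = B u]. *)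
have PU_QZ i j f : rtest f ->
    mconv (delay_P B) U i j f = mconv (delay_Q N Lam A k) Z i j f.
  move=> rf; rewrite mconv_shift ?addNr// mconv_idsubl.
  rewrite /X (delay_weak_equation mk kM k0 lu u_lt lx x_lt rf
    (B := B) (N := N) (A := A) (Lam := Lam)); last first.
    by apply: aeS x_state => t; apply.
  rewrite addrC addKr; apply: eq_bigr => l _.
  rewrite /rconv /delay_P /translates; congr (_ * _).
  by congr (fdistr _); apply/funext => t; rewrite add0r.
(* The output formula [x (t - Lam N)], extended to negative [t]; its distribution is [Z]. *)
exists (fun t => x (- Lam N + t)); split; last split.
- by move=> i; exact: (Lq_loc_shift (- Lam N) (xq i)).
- move=> i j phi tphi; have rphi := test_fun_rtest tphi.
  rewrite (dmx_conv_mconv mQinv (mrmeas_conv mP mU)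
    (N := dmx_conv _ _))//; last first.
    exact: dmx_conv_mconv mP mU _ _.
  (* The chain is [Qinv * (P * U) = Qinv * (Q * Z) = (Qinv * Q) * Z = Z]. *)
  rewrite (eq_mconvr _ _ rphi (fun l f rf => PU_QZ l j f rf)).
  rewrite -(mconvA _ _ mQinv mQ mZ rphi).
  rewrite (@eq_mconvl _ _ _ _ _ _ (@mdelta R d) Z i j phi rphi mZ (QinvQ i)).
  by rewrite mconv_deltal; exact: fdistr_shift (lx i).1 rphi.
- by apply: aeW => t t0; rewrite yx// addrC.
Qed.
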